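(* Let $p\ge 3$ be a prime and let $f_1,\dots,f_n$ be probability mass functions on $\mathbb{Z}/p\mathbb{Z}$. For each $i$ let $f_i=f_{i,\triangle}+f_{i,\square}$ be the $\triangle$–$\square$ decomposition of $f_i$. Then there exists a function $$\delta:\{1,\dots,n\}\times\{\triangle,\square\}^n\to\{+,-\}$$ such that $$\mathfrak{I}^+\subseteq\mathfrak{I}\left(f_{1,\omega_1}^{\delta(1,\omega)}\star f_{2,\omega_2}^{\delta(2,\omega)}\star\cdots\star f_{n,\omega_n}^{\delta(n,\omega)}\right)\quad\text{for each }\omega=(\omega_1,\dots,\omega_n)\in\{\triangle,\square\}^n.$$ Moreover, for any $\alpha\in[0,\infty]$ and any such function $\delta$, $$H_\alpha\left(f_1\star f_2\star\cdots\star f_n\right)\ \ge\ H_\alpha\left(\sum_{\omega=(\omega_1,\dots,\omega_n)\in\{\triangle,\square\}^n} f_{1,\omega_1}^{\delta(1,\omega)}\star f_{2,\omega_2}^{\delta(2,\omega)}\star\cdots\star f_{n,\omega_n}^{\delta(n,\omega)}\right).$$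
   Context: $\mathbb{R}_+$ denotes the nonnegative reals, and $\mathbb{Z}/p\mathbb{Z}$ is identified with the representatives $\{-\frac{p-1}{2},\dots,0,\dots,\frac{p-1}{2}\}$. Convolution: $(f\star g)(k)=\sum_{i+j=k}f(i)g(j)$, with addition in $\mathbb{Z}/p\mathbb{Z}$. Rearrangements: for $f:\mathbb{Z}/p\mathbb{Z}\to\mathbb{R}_+$, $f^+$ is the function having the same values as $f$ with the same multiplicities, arranged so that $f^+(0)\ge f^+(1)\ge f^+(-1)\ge f^+(2)\ge f^+(-2)\ge\cdots\ge f^+(\frac{p-1}{2})\ge f^+(-\frac{p-1}{2})$. Likewise $f^-$ is arranged so that $f^-(0)\ge f^-(-1)\ge f^-(1)\ge\cdots\ge f^-(-\frac{p-1}{2})\ge f^-(\frac{p-1}{2})$. $f$ is $\triangle$-regular if $f^+(z)=f^-(z)$ for all $z\in\mathbb{Z}/p\mathbb{Z}$. $f$ is $\square$-regular if either $f\equiv 0$, or $|\mathrm{supp} f|$ is even and $f^+(z+1)=f^-(z)$ for all $z\in\mathbb{Z}/p\mathbb{Z}$. $\mathfrak{I}(f)$ is the set of all tuples $(i_1,\dots,i_p)$ listing every element of $\mathbb{Z}/p\mathbb{Z}$ exactly once with $f(i_1)\ge\cdots\ge f(i_p)$. $\mathfrak{I}^+=\{(0,+1,-1,\dots,+\frac{p-1}{2},-\frac{p-1}{2})\}$. Two functions $f,g$ are shape-compatible if $\mathfrak{I}(f)\cap\mathfrak{I}(g)\ne\emptyset$. $\triangle$–$\square$ decomposition: every probability mass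 function $f$ on $\mathbb{Z}/p\mathbb{Z}$ can be written uniquely as $f=f_\triangle+f_\square$ with $f_\triangle,f_\square:\mathbb{Z}/p\mathbb{Z}\to\mathbb{R}_+$, $f_\triangle$ $\triangle$-regular, $f_\square$ $\square$-regular, and $f_\triangle,f_\square$ shape-compatible. Rényi entropy of a probability mass function $f$ on $\mathbb{Z}/p\mathbb{Z}$: $H_\alpha(f)=\frac{1}{1-\alpha}\log\sum_i f(i)^\alpha$ for $\alpha\in(0,1)\cup(1,\infty)$, $H_0(f)=\log|\mathrm{supp}(f)|$, $H_1(f)=-\sum_i f(i)\log f(i)$ (with $0\log 0=0$), $H_\infty(f)=-\log\max_i f(i)$. *)

(* Defs.v *)
From HB Require Import structures.
From mathcomp Require Import all_boot all_order all_algebra.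
From mathcomp Require Import boolp classical_sets reals constructive_ereal ereal.
From mathcomp Require Import exp.

Set Implicit Arguments.
Unset Strict Implicit.
Unset Printing Implicit Defensive.

Import Order.TTheory GRing.Theory Num.Theory.
Local Open Scope ring_scope.

(* The ring 'Z_p is Z/pZ only when p > 1; all definitions below are meant for
   p an odd prime. *)

Inductive sign := Plus | Minus.

Inductive kind := Triangle | Square.

Definition kind_to_bool (k : kind) : bool :=
  if k is Triangle then true else false.
Definition bool_to_kind (b : bool) : kind := if b then Triangle else Square.
Lemma kind_to_boolK : cancel kind_to_bool bool_to_kind.
Proof. by case. Qed.
HB.instance Definition _ := Finite.copy kind (can_type kind_to_boolK).

Definition is_pmf (R : realType) (p : nat) (f : {ffun 'Z_p -> R}) : Prop :=
  (forall z, 0 <= f z) /\ \sum_z f z = 1.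

Definition conv (R : realType) (p : nat) (f g : {ffun 'Z_p -> R}) :
    {ffun 'Z_p -> R} :=
  [ffun k => \sum_(ij : 'Z_p * 'Z_p | ij.1 + ij.2 == k) f ij.1 * g ij.2].

Definition dirac0 (R : realType) (p : nat) : {ffun 'Z_p -> R} :=
  [ffun k => (k == 0)%:R].

Lemma convE (R : realType) (p : nat) (f g : {ffun 'Z_p -> R}) k :
  conv f g k = \sum_i f i * g (k - i).
Proof.
rewrite ffunE (reindex_onto (fun i => (i, k - i)) (fun ij => ij.1)) /=.
  by apply: eq_bigl => i; rewrite addrC subrK !eqxx.
by move=> [i j] /= /eqP <-; rewrite addrC addKr.
Qed.

Lemma convC (R : realType) (p : nat) : commutative (@conv R p).
Proof.
move=> f g; apply/ffunP => k; rewrite !convE (reindex_inj (subrI k)) /=.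
by apply: eq_bigr => i _; rewrite mulrC subKr.
Qed.

Lemma convA (R : realType) (p : nat) : associative (@conv R p).
Proof.
move=> f g h; apply/ffunP => k; rewrite convE [RHS]convE.
under eq_bigr => i _ do rewrite convE big_distrr /=.
under [RHS]eq_bigr => i _ do rewrite convE big_distrl /=.
rewrite [RHS]exchange_big /=; apply: eq_bigr => i _.
rewrite [RHS](reindex_inj (addrI i)) /=; apply: eq_bigr => j _.
by rewrite mulrA [i + j - i]addrC addKr opprD addrA.
Qed.

Lemma conv0f (R : realType) (p : nat) : left_id (dirac0 R p) (@conv R p).
Proof.
move=> f; apply/ffunP => k; rewrite convE (bigD1 0) //= ffunE eqxx mul1r subr0.
by rewrite big1 ?addr0 // => i /negPf i0; rewrite ffunE i0 mul0r.
Qed.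

HB.instance Definition _ (R : realType) (p : nat) :=
  Monoid.isComLaw.Build {ffun 'Z_p -> R} (dirac0 R p) (@conv R p)
    (@convA R p) (@convC R p) (@conv0f R p).

(* zigzag p Plus = (0, 1, -1, 2, -2, ...), zigzag p Minus = (0, -1, 1, -2, 2, ...) *)
Definition zigzag (p : nat) (d : sign) : seq 'Z_p :=
  0 :: flatten [seq match d with
                    | Plus => [:: k%:R; - k%:R]
                    | Minus => [:: - k%:R; k%:R]
                    end | k <- iota 1 p.-1./2].

(* The value at the j-th element of the zigzag is the j-th largest value of f,
   counted with multiplicity: rearr Plus f is f^+, rearr Minus f is f^-. *)
Definition rearr (R : realType) (p : nat) (d : sign) (f : {ffun 'Z_p -> R}) :
    {ffun 'Z_p -> R} :=
  [ffun z => nth 0 (sort >=%R (codom f)) (index z (zigzag p d))].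

Lemma zigzag_uniq (p : nat) (d : sign) :
  prime p -> (3 <= p)%N -> uniq (zigzag p d) /\ size (zigzag p d) = p.
Proof.
move=> p_pr p3; have p1 := prime_gt1 p_pr.
have podd : odd p by case: (even_prime p_pr) => // p2; rewrite p2 in p3.
have sz : size (zigzag p d) = p.
  rewrite /= size_flatten /shape -map_comp.
  rewrite (@eq_map _ _ _ (fun=> 2%N)); last by case: d.
  rewrite sumnE big_map big_const_seq count_predT size_iota iter_addn_0 mulnC.
  by rewrite muln2 halfK; case: p podd p1 {p_pr p3} => //= p /negPf ->; rewrite subn0.
split=> //; apply/card_uniqP; rewrite sz.
suff all_in : forall z, z \in zigzag p d.
  by rewrite (eq_card (B := predT)) ?card_ord ?Zp_cast // => z; rewrite all_in.
move=> z; rewrite inE; have [//|z0] /= := eqVneq z 0.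
have zlt : (z < p)%N by rewrite -[X in (_ < X)%N](Zp_cast p1) ltn_ord.
have zp : (0 < z)%N by rewrite lt0n; apply: contra z0 => /eqP e; apply/eqP/val_inj.
have pE : p = (p.-1./2.*2).+1.
  by rewrite halfK; case: p podd {p_pr p3 z z0 zlt zp sz p1} => //= p /negPf ->; rewrite subn0.
apply/flatten_mapP; have [le|lt] := leqP z p.-1./2.
  exists (z : nat); first by rewrite mem_iota zp add1n ltnS.
  by case: d {sz}; rewrite !inE natr_Zp eqxx ?orbT.
exists (p - z)%N.
  rewrite mem_iota add1n ltnS subn_gt0 zlt /= leq_subLR {1}pE -addnn -addnS.
  by rewrite addnC leq_add2r.
by case: d {sz}; rewrite !inE natrB ?(ltnW zlt) // pchar_Zp // natr_Zp sub0r opprK eqxx ?orbT.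
Qed.

Lemma zigzag_perm (p : nat) (d : sign) :
  prime p -> (3 <= p)%N -> perm_eq (zigzag p d) (enum 'Z_p).
Proof.
move=> p_pr p3; have [u s] := zigzag_uniq d p_pr p3.
apply: uniq_perm => //; first exact: enum_uniq.
apply: (uniq_min_size u _ _).2 => [z|]; first by rewrite mem_enum.
by rewrite s -cardE card_ord Zp_cast ?prime_gt1.
Qed.

Lemma map_rearr (R : realType) (p : nat) (d : sign) (f : {ffun 'Z_p -> R}) :
  prime p -> (3 <= p)%N ->
  [seq rearr d f z | z <- zigzag p d] = sort >=%R (codom f).
Proof.
move=> p_pr p3; have [u s] := zigzag_uniq d p_pr p3.
have sc : size (sort >=%R (codom f)) = p.
  by rewrite size_sort size_codom card_ord Zp_cast ?prime_gt1.
apply: (@eq_from_nth _ 0) => [|i]; first by rewrite size_map s sc.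
by rewrite size_map => ilt; rewrite (nth_map 0) // ffunE index_uniq.
Qed.

(* Same values as f with the same multiplicities. *)
Lemma rearr_perm (R : realType) (p : nat) (d : sign) (f : {ffun 'Z_p -> R}) :
  prime p -> (3 <= p)%N -> perm_eq (codom (rearr d f)) (codom f).
Proof.
move=> p_pr p3; apply: (@perm_trans _ (sort >=%R (codom f))).
  by rewrite -(map_rearr d f p_pr p3) codomE perm_map // perm_sym zigzag_perm.
by rewrite perm_sort.
Qed.

Lemma rearr_sorted (R : realType) (p : nat) (d : sign) (f : {ffun 'Z_p -> R}) :
  prime p -> (3 <= p)%N ->
  sorted (fun i j => rearr d f j <= rearr d f i) (zigzag p d).
Proof.
move=> p_pr p3; have /sort_sorted/(_ (codom f)) : total (>=%R : rel R).
  by move=> x y; exact: le_total.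
by rewrite -(map_rearr d f p_pr p3) sorted_map.
Qed.

Definition tri_regular (R : realType) (p : nat) (f : {ffun 'Z_p -> R}) : Prop :=
  forall z, rearr Plus f z = rearr Minus f z.

Definition sq_regular (R : realType) (p : nat) (f : {ffun 'Z_p -> R}) : Prop :=
  (forall z, f z = 0) \/
  (~~ odd #|[pred z | f z != 0]| /\
   forall z, rearr Plus f (z + 1) = rearr Minus f z).

Local Open Scope classical_set_scope.

Definition orderings (R : realType) (p : nat) (f : {ffun 'Z_p -> R}) :
    set (seq 'Z_p) :=
  [set s | perm_eq s (enum 'Z_p) /\ sorted (fun i j => f j <= f i) s].

Definition orderings_plus (p : nat) : set (seq 'Z_p) := [set zigzag p Plus].
Arguments orderings_plus p : clear implicits.

Definition shape_compatible (R : realType) (p : nat)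
    (f g : {ffun 'Z_p -> R}) : Prop :=
  orderings f `&` orderings g !=set0.

Definition tri_sq_decomposition (R : realType) (p : nat)
    (f ft fs : {ffun 'Z_p -> R}) : Prop :=
  [/\ f = ft + fs,
      (forall z, 0 <= ft z) /\ (forall z, 0 <= fs z),
      tri_regular ft,
      sq_regular fs &
      shape_compatible ft fs].

(* For alpha in [0, +oo]; the value at -oo or at negative reals is irrelevant.
   Since ln 0 = 0 and 0 `^ a = 0 for a != 0, the zeros of f contribute nothing;
   the neutral element 0 of the maximum is harmless because f >= 0. *)
Definition renyi (R : realType) (p : nat) (alpha : \bar R)
    (f : {ffun 'Z_p -> R}) : R :=
  match alpha with
  | a%:E =>
      if a == 0 then ln #|[pred z | f z != 0]|%:R
      else if a == 1 then - \sum_z f z * ln (f z)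
      else (1 - a)^-1 * ln (\sum_z f z `^ a)
  | +oo%E => - ln (\big[Num.max/0]_z f z)
  | -oo%E => 0
  end.

(* The convolution of the functions f_{i, omega_i}^{delta(i, omega)}, where
   g i Triangle and g i Square are the two components of f_i. *)
Definition rearr_conv (R : realType) (p n : nat)
    (g : 'I_n -> kind -> {ffun 'Z_p -> R})
    (delta : 'I_n -> {ffun 'I_n -> kind} -> sign) (w : {ffun 'I_n -> kind}) :
    {ffun 'Z_p -> R} :=
  \big[@conv R p/dirac0 R p]_(i < n) rearr (delta i w) (g i (w i)).

Definition admissible (R : realType) (p n : nat)
    (g : 'I_n -> kind -> {ffun 'Z_p -> R})
    (delta : 'I_n -> {ffun 'I_n -> kind} -> sign) : Prop :=
  forall w, orderings_plus p `<=` orderings (rearr_conv g delta w).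

(* Main.v *)
(* By Pollard's theorem, for A, B in Z/pZ and t <= min(|A|, |B|),
   sum_z min(t, 1_A * 1_B (z)) >= t min(p, |A| + |B| - t); this follows by induction
   from Dyson's transform (A, B) -> (A u B, A n B). It bounds the excess
   sum_z (1_A * 1_B - t)_+ from above, and intervals attain the bound. Let I and J be
   the first b and c terms of the zigzag of sign s. The number of representations of
   z as a difference j - i is then sorted along the zigzag of sign s if b is odd and
   of sign -s if b is even. Hence, for any F and |B| = b, F * 1_B is majorized by
   F^e * 1_I, with e = s or e = -s according to the parity of b, and this majorant is
   sorted along the zigzag of sign s. Triangle-regular functions are nonnegative
   combinations of nested sets of odd sizes and square-regular ones of nested sets of
   even sizes, so the same holds for F * h with h regular. The factors can therefore
   be rearranged one after the other, their signs being determined backwards from the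
   last one. Two admissible choices of signs give translates of the same function.
   The majorants for the various omega are sorted along the same zigzag, hence they
   add up, and Renyi entropy is Schur-concave. *)
Require Import Defs.
From HB Require Import structures.
From mathcomp Require Import boolp classical_sets reals constructive_ereal ereal.
From mathcomp Require Import exp.
From mathcomp Require Import all_boot all_order all_algebra.
From mathcomp Require Import zify ring lra.

Set Implicit Arguments.
Unset Strict Implicit.
Unset Printing Implicit Defensive.

Import Order.TTheory GRing.Theory Num.Theory.

Local Open Scope ring_scope.

(** * Pollard's theorem *)

Definition rep (p : nat) (A B : {set 'Z_p}) (z : 'Z_p) : nat :=
  (\sum_x (x \in A) * ((z - x)%R \in B))%N.

Lemma repC (p : nat) (A B : {set 'Z_p}) z : rep A B z = rep B A z.
Proof.
rewrite /rep (reindex_inj (subrI z)) /=; apply: eq_bigr => x _.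
by rewrite subKr mulnC.
Qed.

Lemma sum_mem (T : finType) (A : {set T}) : (\sum_x (x \in A) = #|A|)%N.
Proof. by rewrite -sum1_card [RHS]big_mkcond; apply: eq_bigr => x _; case: (x \in A). Qed.

Lemma sum_rep (p : nat) (A B : {set 'Z_p}) :
  (\sum_z rep A B z = #|A| * #|B|)%N.
Proof.
rewrite /rep exchange_big /= -(sum_mem A) big_distrl /=; apply: eq_bigr => x _.
rewrite -big_distrr /= -(sum_mem B); congr (_ * _)%N.
rewrite (reindex_inj (addIr x)) /=.
by apply: eq_bigr => y _; rewrite addrK.
Qed.

Lemma rep_leq_cardl (p : nat) (A B : {set 'Z_p}) z : (rep A B z <= #|A|)%N.
Proof. by rewrite -sum_mem leq_sum // => x _; case: (_ \in B); lia. Qed.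

Lemma rep_leq_cardr (p : nat) (A B : {set 'Z_p}) z : (rep A B z <= #|B|)%N.
Proof. by rewrite repC rep_leq_cardl. Qed.

(** With i, a, b the indicators of [A :&: B], [A :\: B], [B :\: A], this is the convolution identity
    (i + a)(i + b) = (i + a + b) i + a b. The summands match pointwise in [x] except for i b against
    b i, which [swap] exchanges. *)
Lemma rep_dyson (p : nat) (A B : {set 'Z_p}) z :
  (rep A B z = rep (A :|: B) (A :&: B) z + rep (A :\: B) (B :\: A) z)%N.
Proof.
have swap : (\sum_x (x \in B :\: A) * ((z - x)%R \in A :&: B) =
             \sum_x (x \in A :&: B) * ((z - x)%R \in B :\: A))%N by exact: repC.
rewrite /rep -big_split /=.
apply: (@addIn (\sum_x (x \in A :&: B) * ((z - x)%R \in B :\: A))%N).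
rewrite -{1}swap -!big_split /=; apply: eq_bigr => x _; rewrite !inE.
by do 2! [case: (_ \in A); case: (_ \in B)].
Qed.

Lemma closed_shift_setT (p : nat) (A : {set 'Z_p}) (d : 'Z_p) :
  prime p -> A != set0 -> d != 0 -> {in A, forall x, x + d \in A} ->
  A = setT.
Proof.
move=> p_pr /set0Pn[x xA] d0 closed; apply/setP => y; rewrite inE.
have p1 := prime_gt1 p_pr.
have closedn n : x + d *+ n \in A.
  by elim: n => [|n IH]; rewrite ?addr0 // mulrSr addrA closed.
have dU : d \is a GRing.unit.
  rewrite -[d]natr_Zp unitZpE // prime_coprime // gtnNdvd //.
    by rewrite lt0n; apply: contra d0 => /eqP e; apply/eqP/val_inj.
  by rewrite -[X in (_ < X)%N](Zp_cast p1) ltn_ord.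
have := closedn (nat_of_ord ((y - x) / d)).
by rewrite -mulr_natr natr_Zp mulrC divrK // addrC subrK.
Qed.

(** Otherwise every translate of [B] that meets [A] lies inside [A]; two points of [B] then make [A]
    stable under a nonzero shift, which forces [A] to be everything. *)
Lemma exists_dyson_translate (p : nat) (A B : {set 'Z_p}) :
  prime p -> A != set0 -> A != setT -> (1 < #|B|)%N ->
  exists B' : {set 'Z_p},
    [/\ #|B'| = #|B|, (0 < #|A :&: B'| < #|B|)%N &
        forall t, (\sum_z minn t (rep A B' z) = \sum_z minn t (rep A B z))%N].
Proof.
move=> p_pr A0 AT /card_gt1P[b [b' [bB b'B bb']]].
pose tr (e : 'Z_p) : {set 'Z_p} := [set (x + e)%R | x in B].
have cB e : #|tr e| = #|B| by apply: card_imset; exact: addIr.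
have [/existsP[e He]|/existsPn no] := boolP [exists e, (0 < #|A :&: tr e| < #|B|)%N].
  exists (tr e); split=> // t.
  rewrite (reindex_inj (addIr e)) /=; apply: eq_bigr => z _; congr minn.
  apply: eq_bigr => x _; congr (_ * nat_of_bool _)%N.
  by rewrite addrAC; apply: (mem_imset (f := +%R^~ e)); exact: addIr.
case/negP: AT; apply/eqP; apply: (@closed_shift_setT _ _ (b' - b)) => //.
  by rewrite subr_eq0 eq_sym.
move=> a aA; have := no (a - b); rewrite negb_and -leqNgt leqn0 cards_eq0 -leqNgt.
case/orP => [/eqP/setP/(_ a)|le].
  rewrite !inE aA => /negbT/imsetP; case; exists b => //.
  by rewrite addrC subrK.
have /eqP sub : A :&: tr (a - b) == tr (a - b) by rewrite eqEcard subsetIr cB.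
have : b' + (a - b) \in tr (a - b) by apply/imsetP; exists b'.
by rewrite -sub inE => /andP[+ _]; rewrite addrCA.
Qed.

Lemma pollard (p t : nat) (A B : {set 'Z_p}) :
  prime p -> (t <= #|A|)%N -> (t <= #|B|)%N ->
  (t * minn p (#|A| + #|B| - t) <= \sum_z minn t (rep A B z))%N.
Proof.
move=> p_pr; have [n] := ubnP #|B|; elim: n t A B => // n IHn t A B ltBn tA tB.
have p1 := prime_gt1 p_pr.
have cardZ : #|'Z_p| = p by rewrite card_ord Zp_cast.
have [->|t0] := posnP t; first by rewrite mul0n.
have [tEB|tltB] := eqVneq t #|B|.
  have -> : (\sum_z minn t (rep A B z) = \sum_z rep A B z)%N.
    apply: eq_bigr => z _; apply/minn_idPr; rewrite tEB; exact: rep_leq_cardr.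
  rewrite sum_rep -tEB addnK mulnC leq_mul2r; apply/orP; right; exact: geq_minr.
have A0 : A != set0 by rewrite -card_gt0; lia.
have [->|AT] := eqVneq A setT.
  rewrite (eq_bigr (fun=> t)) => [|z _].
    by rewrite sum_nat_const cardZ mulnC leq_mul2r geq_minl orbT.
  apply/minn_idPl; rewrite (leq_trans tB) // -sum_mem /rep.
  rewrite (reindex_inj (subrI z)) /= leq_sum // => x _.
  by rewrite inE mul1n.
have [|B' [cB' /andP[I0 IB] sumB']] := exists_dyson_translate (B := B) p_pr A0 AT; first lia.
rewrite -sumB' -cB' in ltBn tB tltB IB *; move: B' {cB' sumB'} ltBn tB tltB I0 IB.
move=> {}B ltBn tB tltB I0 IB.
have cU : (#|A :|: B| + #|A :&: B| = #|A| + #|B|)%N by exact: cardsUI.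
have cDA : (#|A :&: B| + #|A :\: B| = #|A|)%N by exact: cardsID.
have cDB : (#|A :&: B| + #|B :\: A| = #|B|)%N by rewrite setIC; exact: cardsID.
(* The two differences are disjoint, so in the bound for this pair the minimum is its second
   term. *)
have cDU : (#|A :\: B| + #|B :\: A| <= p)%N.
  rewrite -[X in (_ <= X)%N]cardZ -cardsUI (_ : (A :\: B) :&: (B :\: A) = set0).
    by rewrite cards0 addn0 max_card.
  by apply/setP => x; rewrite !inE; case: (_ \in A); case: (_ \in B).
set U := A :|: B in cU *; set I := A :&: B in I0 IB cU cDA cDB *.
(* If [t <= #|I|], the pair [(U, I)] alone gives the bound. Otherwise [rep U I] never exceeds
   [#|I|], and the remaining level [t - #|I|] is spent on the two differences. *)
have [tI|It] := leqP t #|I|.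
  apply: (@leq_trans (\sum_z minn t (rep U I z))); last first.
    by apply: leq_sum => z _; rewrite (rep_dyson A B) -/U -/I; lia.
  by rewrite -cU; apply: IHn => //; lia.
apply: (@leq_trans (\sum_z (rep U I z + minn (t - #|I|) (rep (A :\: B) (B :\: A) z)))).
  rewrite big_split sum_rep.
  have := IHn (t - #|I|)%N (A :\: B) (B :\: A).
  move: #|A :\: B| #|B :\: A| cDA cDB cDU => a' b' cDA cDB cDU.
  rewrite (minn_idPr _); last lia.
  move=> H; apply: leq_trans (leq_add (leqnn _) (H _ _ _)); try lia.
  apply: (@leq_trans (t * (#|A| + #|B| - t))); first by rewrite leq_mul2l geq_minr orbT.
  move: #|U| #|I| #|A| #|B| cU cDA cDB tA tB It => u i a b cU cDA cDB tA tB It.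
  (* Substituting [s = t - i] and the slack [w] removes the subtractions; both sides become equal
     polynomials. *)
  have [s [w [-> -> -> ->]]] : exists s w,
      [/\ t = i + s, u = i + s + w, a + b = i + i + s + w & a' + b' = s + w]%N.
    by exists (t - i)%N, (a' + b' - (t - i))%N; split; lia.
  have [-> ->] : (i + i + s + w - (i + s) = i + w /\ i + s - i = s)%N by lia.
  rewrite addKn.
  by rewrite mulnDl !mulnDr !mulnDl; lia.
apply: leq_sum => z _; rewrite (rep_dyson A B) -/U -/I.
have := rep_leq_cardr U I z; lia.
Qed.

(** The parts of [rep A B] below and above [t] add up to [#|A| * #|B|]. The terms of the maximum
    mirror those of the minimum in [pollard], since ab - t(a + b - t) = (a - t)(b - t). *)
Lemma sum_subn_rep (p t : nat) (A B : {set 'Z_p}) : prime p ->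
  (\sum_z (rep A B z - t) <= maxn (#|A| * #|B| - t * p)
                                  ((#|A| - t) * (#|B| - t)))%N.
Proof.
move=> p_pr.
have [tA|At] := leqP t #|A|; last first.
  rewrite big1 // => z _; have := rep_leq_cardl A B z; lia.
have [tB|Bt] := leqP t #|B|; last first.
  rewrite big1 // => z _; have := rep_leq_cardr A B z; lia.
have := pollard p_pr tA tB.
have : (\sum_z minn t (rep A B z) + \sum_z (rep A B z - t) = #|A| * #|B|)%N.
  by rewrite -big_split /= -sum_rep; apply: eq_bigr => z _; lia.
set x := (\sum_z _)%N; set y := (\sum_z _)%N; move: x y => x y.
move: #|A| #|B| tA tB => a b tA tB.
have [_|_] := leqP p (a + b - t)%N.
  by move=> e l; rewrite leq_max; apply/orP; left; rewrite -e; move: l; move: (t * p)%N => ?; lia.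
have [c ->] : exists c, a = (t + c)%N by exists (a - t)%N; lia.
have [d ->] : exists d, b = (t + d)%N by exists (b - t)%N; lia.
have -> : (t + c + (t + d) - t = t + c + d)%N by lia.
by rewrite !addKn !mulnDl !mulnDr; lia.
Qed.

(** * Convolutions of initial segments of zigzags *)

Definition sgmul (d e : sign) : sign :=
  match d, e with Plus, e => e | Minus, Plus => Minus | Minus, Minus => Plus end.

Definition sgact (V : zmodType) (d : sign) (z : V) : V :=
  if d is Plus then z else - z.

Definition zz (p : nat) (d : sign) (i : nat) : 'Z_p :=
  sgact d (if odd i then (uphalf i)%:R else - i./2%:R).

Lemma zz_sgmul (p : nat) (d e : sign) i : zz p (sgmul d e) i = sgact d (zz p e i).
Proof. by rewrite /zz; case: d; case: e => //=; rewrite opprK. Qed.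

Lemma zigzagE (p : nat) (d : sign) :
  zigzag p d = [seq zz p d i | i <- iota 0 (p.-1./2.*2).+1].
Proof.
rewrite /zigzag /=; congr (_ :: _); first by case: d; rewrite /zz /= ?oppr0.
elim: p.-1./2 => // n IH.
have -> : iota 1 n.+1 = iota 1 n ++ [:: n.+1] by rewrite -[X in iota _ X]addn1 iotaD.
have -> : iota 1 n.+1.*2 = iota 1 n.*2 ++ [:: n.*2.+1; n.*2.+2].
  by rewrite doubleS -[X in iota _ X]addn2 iotaD.
rewrite !map_cat flatten_cat IH; congr (_ ++ _).
rewrite /= /zz /= odd_double /= ?uphalf_double ?doubleK.
by case: d {IH}; rewrite //= opprK.
Qed.

Lemma nth_zigzag (p : nat) (d : sign) i :
  odd p -> (i < p)%N -> nth 0 (zigzag p d) i = zz p d i.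
Proof.
move=> op ip; rewrite zigzagE (_ : (p.-1./2.*2).+1 = p); last lia.
by rewrite (nth_map 0%N) ?size_iota // nth_iota.
Qed.

Lemma bump0 i : bump 0 i = i.+1. Proof. by []. Qed.

(** The first [n] terms of a zigzag form an interval: each new term extends it at the right or left
    end, according to the parity of [n] and the sign. *)
Lemma sum_zz (p : nat) (d : sign) (n : nat) (phi : 'Z_p -> nat) :
  (\sum_(i < n) phi (zz p d i) =
   \sum_(i < n) phi (i%:R - (if d is Plus then n.-1./2 else n./2)%:R)%R)%N.
Proof.
elim: n => [|n IH]; first by rewrite !big_ord0.
rewrite big_ord_recr /= {}IH /zz.
have [on|en] := boolP (odd n); case: d => /=.
- rewrite [RHS]big_ord_recr /= (_ : n.-1./2 = n./2); last lia.
  congr (_ + phi _); rewrite -natrB; last lia.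
  by congr (_%:R); lia.
- rewrite [RHS]big_ord_recl addnC; congr (phi _ + _); first by rewrite sub0r.
  apply: eq_bigr => i _; congr phi; rewrite (_ : uphalf n = n./2.+1); last lia.
  by rewrite /= bump0 -!natr1 opprD addrACA subrr addr0.
- case: n en => [|n] en; first by rewrite big_ord0 big_ord_recl big_ord0 addn0 add0n sub0r.
  rewrite [RHS]big_ord_recl addnC; congr (phi _ + _); first by rewrite sub0r.
  apply: eq_bigr => i _; congr phi; rewrite (_ : n.+1./2 = n./2.+1); last by move: en => /=; lia.
  by rewrite /= bump0 -!natr1 opprD addrACA subrr addr0.
- rewrite [RHS]big_ord_recr /= (_ : uphalf n = n./2); last lia.
  congr (_ + phi _); rewrite opprK -natrB; last lia.
  by congr (_%:R); lia.
Qed.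

(** * Representation counts of intervals modulo [p] *)

Definition krep (p c b : nat) (z : 'Z_p) : nat :=
  \sum_(i < c) \sum_(j < b) ((i + j)%:R == z).

Lemma krep_sym (p c b : nat) (z : 'Z_p) :
  krep c b z = krep c b ((c.-1 + b.-1)%:R - z).
Proof.
rewrite /krep (reindex_inj rev_ord_inj); apply: eq_bigr => i _.
rewrite (reindex_inj rev_ord_inj); apply: eq_bigr => j _ /=.
rewrite (_ : c - i.+1 = c.-1 - i)%N; last lia.
rewrite (_ : b - j.+1 = b.-1 - j)%N; last lia.
have ic := ltn_ord i; have jb := ltn_ord j.
rewrite (_ : c.-1 - i + (b.-1 - j) = c.-1 + b.-1 - (i + j))%N; last lia.
rewrite natrB; last lia.
by rewrite subr_eq [in RHS]eq_sym subr_eq addrC.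
Qed.

(** Both sides count the pairs in [0, c] x [0, b) with sum [z + 1], isolating either the last or the
    first value of [i]. *)
Lemma krep_succ (p c b : nat) (z : 'Z_p) :
  (krep c b (z + 1)%R + \sum_(j < b) ((c + j)%:R == (z + 1)%R) =
   krep c b z + \sum_(j < b) (j%:R == (z + 1)%R))%N.
Proof.
rewrite /krep.
transitivity (\sum_(i < c.+1) \sum_(j < b) ((i + j)%:R == (z + 1)%R))%N.
  by rewrite big_ord_recr.
rewrite big_ord_recl addnC; congr (_ + _)%N.
apply: eq_bigr => i _; apply: eq_bigr => j _; congr nat_of_bool.
by rewrite lift0 addSn -natr1 (inj_eq (addIr 1)).
Qed.

(* On the hook of the pairs with i = 0 or j = b, the sum i + j takes each of the values
   0, ..., b + c once. *)
Lemma krep_hook (p c b : nat) (z : 'Z_p) :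
  (krep c.+1 b.+1 (z + 1)%R =
   krep c b z + \sum_(l < b.+1 + c) (l%:R == (z + 1)%R))%N.
Proof.
rewrite /krep big_ord_recl addnC big_split_ord addnA addnAC; congr (_ + _)%N.
rewrite -big_split; apply: eq_bigr => i _; rewrite big_ord_recr /=; congr (_ + nat_of_bool _)%N.
  apply: eq_bigr => j _; congr nat_of_bool.
  by rewrite bump0 addSn -natr1 (inj_eq (addIr 1)).
by rewrite bump0 addSn addnC addSn.
Qed.

(** If [z] is represented at all, [z + 1] is one of the sums on the hook, so the hook contributes at
    least 1. This lowers the level and both lengths by one in [sum_subn_krep]. *)
Lemma krep_subn1 (p c b : nat) (z : 'Z_p) :
  (krep c b z <= krep c.+1 b.+1 (z + 1)%R - 1)%N.
Proof.
rewrite krep_hook; have [->//|k0] := posnP (krep c b z).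
suff : (0 < \sum_(l < b.+1 + c) (l%:R == (z + 1)%R))%N by lia.
move: k0; rewrite !lt0n /krep; apply: contra.
rewrite !sum_nat_eq0 => /forallP h; apply/forallP => i; rewrite sum_nat_eq0; apply/forallP => j /=.
have ijlt : ((i + j).+1 < b.+1 + c)%N by have := ltn_ord i; have := ltn_ord j; lia.
have := h (Ordinal ijlt).
by rewrite /= -natr1 (inj_eq (addIr 1)).
Qed.

Lemma sum_krep (p c b : nat) : (\sum_(z : 'Z_p) krep c b z = c * b)%N.
Proof.
rewrite /krep exchange_big /=.
rewrite (eq_bigr (fun=> b)) => [|i _]; first by rewrite sum_nat_const card_ord.
rewrite exchange_big /= (eq_bigr (fun=> 1%N)) => [|j _]; first by rewrite sum_nat_const card_ord muln1.
by rewrite (bigD1 (i + j)%:R) //= eqxx big1 ?addn0 // => k; rewrite eq_sym => /negPf ->.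
Qed.

(** This lower bound matches the second term of the maximum in [sum_subn_rep]. *)
Lemma sum_subn_krep (p c b t : nat) :
  ((c - t) * (b - t) <= \sum_(z : 'Z_p) (krep c b z - t))%N.
Proof.
elim: t c b => [|t IH] c b.
  by under eq_bigr do rewrite subn0; rewrite sum_krep !subn0.
case: c => [|c]; first by rewrite sub0n.
case: b => [|b]; first by rewrite sub0n muln0.
rewrite !subSS (reindex_inj (addIr 1)) /=; apply: leq_trans (IH c b) _.
by apply: leq_sum => z _; rewrite -[t.+1]add1n subnDA leq_sub2r // krep_subn1.
Qed.

Lemma natr_eq_Zp (p m n : nat) : (1 < p)%N ->
  (m%:R == n%:R :> 'Z_p) = (m == n %[mod p]).
Proof. by move=> p1; rewrite -(inj_eq val_inj) /= !val_Zp_nat. Qed.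

Lemma sum_natr_eq_leq1 (p b : nat) (z : 'Z_p) : (1 < p)%N -> (b <= p)%N ->
  (\sum_(j < b) (j%:R == z) <= 1)%N.
Proof.
move=> p1 bp; rewrite -(natr_Zp z).
have zp : (z < p)%N by rewrite -[X in (_ < X)%N](Zp_cast p1) ltn_ord.
apply: (@leq_trans (\sum_(j < b) (nat_of_ord j == z))); last first.
  have [zb|bz] := ltnP z b.
    rewrite (bigD1 (Ordinal zb)) //= eqxx big1 // => i.
    by rewrite -val_eqE /= => /negPf ->.
  by rewrite big1 // => i _; have := ltn_ord i; lia.
apply: leq_sum => j _; rewrite natr_eq_Zp // !modn_small //.
by apply: leq_trans bp.
Qed.

(** By [krep_succ], going from z to z + 1 adds the hits of z + 1 in [0, b) and removes those in [c,
    c + b). The count is symmetric about s + e/2; on the half circle to the right of this centre, a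
    point hit by the first interval is also hit by the second. *)
Lemma krep_decr (p c b e s k : nat) : (1 < p)%N -> odd p -> (c <= p)%N -> (b <= p)%N ->
  (c + b = s.*2 + e + 2)%N -> (e <= 1)%N -> (e <= k < p./2 + e)%N ->
  (krep c b ((k + s)%:R + 1 : 'Z_p)%R <= krep c b ((k + s)%:R : 'Z_p))%N.
Proof.
move=> p1 op cp bp cbE e1 /andP[ek kp].
have E := krep_succ c b ((k + s)%:R : 'Z_p).
rewrite -(leq_add2r (\sum_(j < b) (j%:R == ((k + s)%:R + 1 : 'Z_p)%R))) -E leq_add2l natr1.
have [->//|] := posnP (\sum_(j < b) (j%:R == (k + s).+1%:R :> 'Z_p)).
have := sum_natr_eq_leq1 ((k + s).+1%:R : 'Z_p) p1 bp => le1 gt0.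
apply: leq_trans le1 _; move: gt0; rewrite !lt0n; apply: contra.
rewrite !sum_nat_eq0 => /forallP h; apply/forallP => j /=.
rewrite natr_eq_Zp // eqb0; apply/negP => /eqP jE.
have jb := ltn_ord j.
(* Here k + s + 1 is less than 2p, so it wraps around at most once. *)
have {}jE : (k + s).+1 = j \/ (k + s).+1 = (j + p)%N.
  move: jE; rewrite modn_small; last lia.
  have [lt|ge] := ltnP (k + s).+1 p; first by rewrite modn_small // => ->; left.
  by rewrite -(subnK ge) modnDr modn_small; lia.
have lt : ((k + s).+1 - c < b)%N by lia.
have := h (Ordinal lt); rewrite /= subnKC ?eqxx //; lia.
Qed.

(** Differences rather than sums, because a convolution summed over [C] evaluates [F] at [c - j]. *)
Definition zrep (p : nat) (d : sign) (c b : nat) (z : 'Z_p) : nat :=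
  \sum_(i < c) \sum_(j < b) ((zz p d i - zz p d j)%R == z).

Lemma zrep_sgmul (p : nat) (e d : sign) (c b : nat) (z : 'Z_p) :
  zrep (sgmul e d) c b (sgact e z) = zrep d c b z.
Proof.
apply: eq_bigr => i _; apply: eq_bigr => j _.
by rewrite !zz_sgmul; case: e => //=; rewrite -opprD (inj_eq oppr_inj).
Qed.

(** Both segments are intervals by [sum_zz]; reversing the subtracted one turns differences into
    sums. *)
Lemma zrepE (p : nat) (d : sign) (c b : nat) (z : 'Z_p) :
  let u n := if d is Plus then n.-1./2 else n./2 in
  zrep d c b z = krep c b (z + (u c + (b.-1 - u b))%:R).
Proof.
move=> u; rewrite /zrep.
rewrite (sum_zz d c (fun x => \sum_(j < b) ((x - zz p d j)%R == z))%N).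
apply: eq_bigr => i _.
rewrite (sum_zz d b (fun x => (i%:R - (u c)%:R - x == z) : nat)).
rewrite (reindex_inj rev_ord_inj); apply: eq_bigr => j _ /=; congr nat_of_bool.
have jb := ltn_ord j.
rewrite -/(u b) -[RHS]subr_eq; congr (_ == _).
rewrite (_ : b - j.+1 = b.-1 - j)%N; last lia.
have ub : (u b <= b.-1)%N by rewrite /u; case: (d); lia.
have jb1 : (j <= b.-1)%N by lia.
by rewrite !natrD (natrB _ ub) (natrB _ jb1); ring.
Qed.

Definition bsign (b : nat) : sign := if odd b then Plus else Minus.

Lemma zz_plus_cases (p i : nat) : zz p Plus i =
  if odd i then (uphalf i)%:R else - i./2%:R.
Proof. by []. Qed.

Lemma zrep_decr (p b c i : nat) : (1 < p)%N -> odd p -> (c <= p)%N -> (b <= p)%N ->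
  (i.+1 < p)%N ->
  (zrep (bsign b) c b (zz p Plus i.+1) <= zrep (bsign b) c b (zz p Plus i))%N.
Proof.
move=> p1 op cp bp ip.
have [->|b0] := posnP b; first by rewrite /zrep !big1 // => ? _; rewrite big_ord0.
have [->|c0] := posnP c; first by rewrite /zrep !big_ord0.
rewrite !zrepE.
(* The sign [bsign b] puts the centre of symmetry of the count at e/2, that is at 0 or 1/2. The
   steps of 0, 1, -1, 2, -2, ... then alternate between the reflection z -> e - z, which preserves
   the count, and a decrease given by [decr]. *)
set s := (_ + _)%N; pose e := (odd (b + c) : nat).
have cbE : (c + b = s.*2 + e + 2)%N.
  by rewrite /s /bsign /e; case: ifP => ob; lia.
have sE : (s + s + e = c.-1 + b.-1)%N by lia.
have e1 : (e <= 1)%N by rewrite /e; case: (odd _).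
have sym (z : 'Z_p) : krep c b (z + s%:R) = krep c b (e%:R - z + s%:R).
  rewrite krep_sym; congr krep; rewrite -sE !natrD; ring.
have decr k : (e <= k < p./2 + e)%N ->
    (krep c b (k.+1%:R + s%:R : 'Z_p)%R <= krep c b (k%:R + s%:R : 'Z_p)%R)%N.
  by move=> ek; have := krep_decr p1 op cp bp cbE e1 ek; rewrite natrD addrAC natr1.
rewrite !zz_plus_cases /=; have [oi|ei] := boolP (odd i) => /=.
  rewrite sym opprK -natrD.
  have [e0|e1'] : e = 0%N \/ e = 1%N by lia.
    by rewrite e0 add0n (_ : uphalf i = i.+1./2) //; lia.
  rewrite e1' add1n; apply: decr; lia.
rewrite [leqRHS]sym opprK -natrD.
have [e0|e1'] : e = 0%N \/ e = 1%N by lia.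
  rewrite e0 add0n; apply: decr; lia.
by rewrite e1' add1n.
Qed.

Lemma odd_prime_ge3 p : prime p -> (3 <= p)%N -> odd p.
Proof. by move=> p_pr p3; case: (even_prime p_pr) => // p2; rewrite p2 in p3. Qed.

Lemma card_Zp_type p : prime p -> #|{: 'Z_p}| = p.
Proof. by move=> p_pr; rewrite card_ord Zp_cast ?prime_gt1. Qed.

Lemma big_zigzag (T : Type) (idx : T) (op : Monoid.com_law idx) (p : nat) (d : sign)
    (F : 'Z_p -> T) : prime p -> (3 <= p)%N ->
  \big[op/idx]_z F z = \big[op/idx]_(k < p) F (zz p d k).
Proof.
move=> p_pr p3; have op' := odd_prime_ge3 p_pr p3.
rewrite -big_enum -(perm_big _ (zigzag_perm d p_pr p3)) /= zigzagE big_map.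
have -> : (p.-1./2.*2).+1 = p by lia.
by rewrite -{1}[p]subn0 -/(index_iota 0 p) big_mkord.
Qed.

Lemma zz_sgact (p : nat) (d : sign) k : zz p d k = sgact d (zz p Plus k).
Proof. by []. Qed.

Lemma zrep_zz (p : nat) (e d : sign) (c b k : nat) :
  zrep (sgmul e d) c b (zz p e k) = zrep d c b (zz p Plus k).
Proof. by rewrite zz_sgact zrep_sgmul. Qed.

Lemma zrep_sorted (p : nat) (e : sign) (c b i j : nat) :
  prime p -> (3 <= p)%N -> (c <= p)%N -> (b <= p)%N -> (i <= j < p)%N ->
  (zrep (sgmul e (bsign b)) c b (zz p e j) <=
   zrep (sgmul e (bsign b)) c b (zz p e i))%N.
Proof.
move=> p_pr p3 cp bp /andP[ij jp]; rewrite !zrep_zz.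
elim: j ij jp => [|j IH]; first by case: i.
rewrite leq_eqVlt => /orP[/eqP->//|ij] jp.
apply: leq_trans (IH _ _); [|by []|lia].
by apply: zrep_decr; rewrite ?prime_gt1 ?odd_prime_ge3.
Qed.

Lemma sum_subn_zrep (p : nat) (d : sign) (c b t : nat) :
  (\sum_(z : 'Z_p) (zrep d c b z - t) = \sum_(z : 'Z_p) (krep c b z - t))%N.
Proof.
rewrite [RHS](reindex_inj (addIr ((if d is Plus then c.-1./2 else c./2) +
  (b.-1 - if d is Plus then b.-1./2 else b./2))%N%:R)) /=.
by apply: eq_bigr => z _; rewrite zrepE.
Qed.

(** For any level [t], the sum over [A] is at most [#|A| * t] plus the total excess over [t]. With
    [t] the last of the [#|A|] largest zigzag counts, those counts attain this bound, so only the
    excesses remain to be compared. *)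
Lemma sum_rep_le_zrep (p : nat) (e : sign) (A B C : {set 'Z_p}) :
  prime p -> (3 <= p)%N ->
  (\sum_(z in A) rep C B z <=
   \sum_(k < #|A|) zrep (sgmul e (bsign #|B|)) #|C| #|B| (zz p e k))%N.
Proof.
move=> p_pr p3.
have cardp (D : {set 'Z_p}) : (#|D| <= p)%N.
  by rewrite -[X in (_ <= X)%N](card_Zp_type p_pr) max_card.
have := cardp A; have := sum_subn_rep; have := cardp C; have := cardp B.
set b := #|B|; set c := #|C|; set a := #|A| => bp cp excess ap.
set d := sgmul e _; pose q k := zrep d c b (zz p e k).
have [a0|a0] := posnP a.
  by rewrite /a in a0; rewrite (cards0_eq a0) big_set0.
pose t := q a.-1.
have qS i j : (i <= j < p)%N -> (q j <= q i)%N by exact: zrep_sorted.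
have upper : (\sum_(z in A) rep C B z <= a * t + \sum_z (rep C B z - t))%N.
  apply: (@leq_trans (\sum_(z in A) (t + (rep C B z - t)))).
    by apply: leq_sum => z _; rewrite -leq_subLR.
  rewrite big_split /= sum_nat_const leq_add2l.
  by rewrite [leqRHS](bigID (mem A)) /= leq_addr.
apply: leq_trans upper _.
have lower : (a * t + \sum_(z : 'Z_p) (zrep d c b z - t) = \sum_(k < a) q k)%N.
  rewrite (@big_zigzag nat 0%N addn p e) //.
  have -> : (\sum_(k < p) (zrep d c b (zz p e k) - t) = \sum_(k < a) (q k - t))%N.
    rewrite [RHS](big_ord_widen p (fun k => q k - t)%N) // [RHS]big_mkcond /=.
    apply: eq_bigr => k _; case: ifPn => //; rewrite -leqNgt => ak.
    by apply/eqP; rewrite subn_eq0; apply: qS; have := ltn_ord k; lia.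
  rewrite -[X in (X * t)%N](card_ord a) -sum_nat_const -big_split /=.
  by apply: eq_bigr => k _; rewrite subnKC // qS //; have := ltn_ord k; lia.
rewrite -/d -lower leq_add2l.
(* The second term of the maximum is handled by [sum_subn_krep], the first by the total
   [#|C| * #|B|] of the interval counts. *)
apply: leq_trans (excess p t C B p_pr) _; rewrite sum_subn_zrep geq_max sum_subn_krep andbT.
rewrite -(sum_krep p) leq_subLR -[X in (_ * X)%N](card_Zp_type p_pr) mulnC.
rewrite -sum_nat_const -big_split /=.
by apply: leq_sum => z _; rewrite -leq_subLR.
Qed.

(** * Majorization *)

(** Summation by parts, for [g] of any sign: when [D] has total zero, the weighted sum is
    nonnegative. *)
Lemma abel_sum (R : numDomainType) (n : nat) (D g : nat -> R) :
  (forall c, (c <= n.+1)%N -> 0 <= \sum_(i < c) D i) ->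
  (forall i, (i < n)%N -> g i.+1 <= g i) ->
  g n * \sum_(i < n.+1) D i <= \sum_(i < n.+1) D i * g i.
Proof.
elim: n => [|n IH] D0 gS; first by rewrite !big_ord1 mulrC.
rewrite big_ord_recr [leRHS]big_ord_recr /= mulrDr [g _ * D _]mulrC lerD2r.
apply: le_trans (IH _ _); last 2 first.
- by move=> c cn; apply: D0; lia.
- by move=> i ilt; apply: gS; lia.
by apply: ler_wpM2r; [exact: (D0 n.+1)|exact: gS].
Qed.

Lemma ler_sum_abel (R : numDomainType) (n : nat) (x y g : nat -> R) :
  (forall c, (c <= n)%N -> \sum_(i < c) x i <= \sum_(i < c) y i) ->
  (forall i, (i.+1 < n)%N -> g i.+1 <= g i) ->
  (forall i, (i < n)%N -> 0 <= g i) ->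
  \sum_(i < n) x i * g i <= \sum_(i < n) y i * g i.
Proof.
case: n => [|n] xy gS g0; first by rewrite !big_ord0.
rewrite -subr_ge0 -sumrB; under eq_bigr do rewrite -mulrBl.
have D0 c : (c <= n.+1)%N -> 0 <= \sum_(i < c) (y i - x i).
  by move=> cn; rewrite sumrB subr_ge0 xy.
apply: le_trans (abel_sum (D := fun i => y i - x i) D0 gS).
by apply: mulr_ge0; [exact: g0 | exact: D0].
Qed.

Section Majorization.
Variables (R : realDomainType) (p : nat).
Implicit Types (F G : 'Z_p -> R) (d : sign).

Definition zsorted d G := forall k, (k.+1 < p)%N -> G (zz p d k.+1) <= G (zz p d k).

(* If G is sorted along the zigzag, the right-hand side is the sum of the #|C| largest
   values of G, and this is weak majorization. *)
Definition maj d F G := forall C : {set 'Z_p},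
  \sum_(z in C) F z <= \sum_(k < #|C|) G (zz p d k).

Definition desc F : seq 'Z_p := sort (fun x y => F y <= F x) (enum 'Z_p).

Definition top F c : {set 'Z_p} := [set z in take c (desc F)].

Lemma desc_perm F : perm_eq (desc F) (enum 'Z_p).
Proof. by rewrite perm_sort. Qed.

Lemma desc_uniq F : uniq (desc F).
Proof. by rewrite (perm_uniq (desc_perm F)) enum_uniq. Qed.

Lemma map_desc F : map F (desc F) = sort >=%R (map F (enum 'Z_p)).
Proof. by rewrite sort_map. Qed.

Lemma desc_sorted F : sorted (fun x y => F y <= F x) (desc F).
Proof. by apply: sort_sorted => x y; exact: le_total. Qed.

Hypothesis p_pr : prime p.

Lemma size_desc F : size (desc F) = p.
Proof. by rewrite (perm_size (desc_perm F)) -cardE card_Zp_type. Qed.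

Lemma nth_desc_le F k : (k.+1 < p)%N ->
  F (nth 0 (desc F) k.+1) <= F (nth 0 (desc F) k).
Proof.
move=> kp; have /(sortedP 0) FS := desc_sorted F.
by apply: FS; rewrite size_desc.
Qed.

Lemma sum_desc F (phi : 'Z_p -> R) :
  \sum_z phi z = \sum_(k < p) phi (nth 0 (desc F) k).
Proof.
rewrite -big_enum -(perm_big _ (desc_perm F)) /= (big_nth 0) size_desc.
by rewrite big_mkord.
Qed.

Lemma size_take_desc F c : (c <= p)%N -> size (take c (desc F)) = c.
Proof. by move=> cp; rewrite size_takel ?size_desc. Qed.

Lemma card_top F c : (c <= p)%N -> #|top F c| = c.
Proof.
move=> cp; rewrite cardsE -[RHS](size_take_desc F cp); apply/card_uniqP.
exact/take_uniq/desc_uniq.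
Qed.

Lemma sum_top F c (phi : 'Z_p -> R) : (c <= p)%N ->
  \sum_(z in top F c) phi z = \sum_(k < c) phi (nth 0 (desc F) k).
Proof.
move=> cp; under eq_bigl do rewrite inE.
rewrite -big_uniq /=; last exact/take_uniq/desc_uniq.
rewrite (big_nth 0) size_take_desc // big_mkord.
by apply: eq_bigr => k _; rewrite nth_take.
Qed.

(** Two summations by parts. With [r] listed in decreasing order, [F] is first replaced by [G]; then
    [r] is replaced by [q] against the values of [G], which decrease along the zigzag. *)
Lemma maj_sum_mul d F G r q : (3 <= p)%N ->
  maj d F G -> maj d r q -> zsorted d G -> zsorted d q ->
  (forall z, 0 <= G z) -> (forall z, 0 <= r z) ->
  \sum_z F z * r z <= \sum_z G z * q z.
Proof.
move=> p3 FG rq GS qS G0 r0.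
rewrite (sum_desc r) [leRHS](big_zigzag _ d) //=.
apply: (@le_trans _ _ (\sum_(k < p) G (zz p d k) * r (nth 0 (desc r) k))).
  apply: (ler_sum_abel (x := fun k => F (nth 0 (desc r) k))
    (y := fun k => G (zz p d k)) (g := fun k => r (nth 0 (desc r) k))) => //.
    by move=> c cp; rewrite -sum_top //; have := FG (top r c); rewrite card_top.
  exact: nth_desc_le.
rewrite (eq_bigr _ (fun k _ => mulrC _ _)) [leRHS](eq_bigr _ (fun k _ => mulrC _ _)).
apply: (ler_sum_abel (x := fun k => r (nth 0 (desc r) k))
    (y := fun k => q (zz p d k)) (g := fun k => G (zz p d k))) => //.
by move=> c cp; rewrite -sum_top //; have := rq (top r c); rewrite card_top.
Qed.

End Majorization.

Lemma index_zz (p : nat) (d : sign) k : prime p -> (3 <= p)%N -> (k < p)%N ->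
  index (zz p d k) (zigzag p d) = k.
Proof.
move=> p_pr p3 kp; have [u s] := zigzag_uniq d p_pr p3.
by rewrite -(nth_zigzag d (odd_prime_ge3 p_pr p3) kp) index_uniq // s.
Qed.

Lemma big_zz_index (T : Type) (idx : T) (op : Monoid.com_law idx) (p : nat) (d : sign)
    (P : pred nat) (F : 'Z_p -> T) : prime p -> (3 <= p)%N ->
  \big[op/idx]_(z in [set z | P (index z (zigzag p d))]) F z =
  \big[op/idx]_(k < p | P k) F (zz p d k).
Proof.
move=> p_pr p3; rewrite big_mkcond (@big_zigzag _ _ _ p d) // [RHS]big_mkcond.
by apply: eq_bigr => k _; rewrite inE index_zz.
Qed.

Lemma sum_ltn_ord (n m : nat) : (\sum_(i < n) (i < m) = minn n m)%N.
Proof.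
elim: n => [|n IH]; first by rewrite big_ord0 min0n.
by rewrite big_ord_recr /= IH; lia.
Qed.

Section RealMajorization.
Variables (R : realDomainType) (p : nat).
Hypotheses (p_pr : prime p) (p3 : (3 <= p)%N).
Implicit Types (F G : 'Z_p -> R) (d : sign).

(** Along the zigzag, the indicator of [C] has partial sums no larger than that of the first [#|C|]
    positions; summation by parts against [G] concludes. *)
Lemma zsorted_maj d G : (forall z, 0 <= G z) -> zsorted d G -> maj d G G.
Proof.
move=> G0 GS C; pose x k : R := (zz p d k \in C)%:R.
have cC : #|C|%:R = \sum_(k < p) x k.
  by rewrite -sum1_card natr_sum big_mkcond (@big_zigzag _ _ _ p d) //=;
     apply: eq_bigr => k _; rewrite /x; case: ifP.
have Cp : (#|C| <= p)%N by rewrite -[X in (_ <= X)%N](card_Zp_type p_pr) max_card.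
have -> : \sum_(z in C) G z = \sum_(k < p) x k * G (zz p d k).
  rewrite big_mkcond (@big_zigzag _ _ _ p d) //=.
  by apply: eq_bigr => k _; rewrite /x; case: ifP => _; rewrite ?mul1r ?mul0r.
have -> : \sum_(k < #|C|) G (zz p d k) = \sum_(k < p) (k < #|C|)%:R * G (zz p d k).
  rewrite (big_ord_widen p (fun k => G (zz p d k))) // big_mkcond.
  by apply: eq_bigr => k _; case: ifP => _; rewrite ?mul1r ?mul0r.
apply: (ler_sum_abel (x := x) (y := fun k => (k < #|C|)%:R)
  (g := fun k => G (zz p d k))) => // c cp.
have -> : \sum_(i < c) (i < #|C|)%:R = (minn c #|C|)%:R :> R.
  by rewrite -natr_sum sum_ltn_ord.
have [cC'|Cc] := leqP c #|C|.
  rewrite -[c in leRHS]card_ord -sum1_card natr_sum; apply: ler_sum => k _.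
  by rewrite /x; case: (_ \in _).
rewrite cC -(subnKC cp) big_split_ord /= lerDl sumr_ge0 //.
Qed.

(** Testing on the first [k] terms together with the one at index [k.+1] compares the values at
    [k.+1] and [k]. Sortedness of a convolution can thus be read off from a majorization. *)
Lemma maj_zsorted d G : maj d G G -> zsorted d G.
Proof.
move=> GG k kp; pose P i := (i < k)%N || (i == k.+1).
have splitP (T : Type) (idx : T) (op : Monoid.com_law idx) (F : 'Z_p -> T) :
    \big[op/idx]_(z in [set z | P (index z (zigzag p d))]) F z =
    op (F (zz p d k.+1)) (\big[op/idx]_(i < k) F (zz p d i)).
  rewrite big_zz_index // (bigD1 (Ordinal kp)) ?/P ?eqxx ?orbT //=; congr (op _ _).
  rewrite (big_ord_widen p (fun i => F (zz p d i))); last lia.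
  by apply: eq_bigl => i; rewrite -val_eqE /=; lia.
have := GG [set z | P (index z (zigzag p d))].
have -> : #|[set z | P (index z (zigzag p d))]| = k.+1.
  by rewrite -sum1_card (splitP _ _ addn) sum_nat_const card_ord muln1.
rewrite (splitP _ _ +%R).
by rewrite big_ord_recr /= addrC lerD2l.
Qed.

Lemma maj_rep e (B C : {set 'Z_p}) :
  maj e (fun z => (rep C B z)%:R : R)
        (fun z => (zrep (sgmul e (bsign #|B|)) #|C| #|B| z)%:R).
Proof. by move=> A; rewrite -!natr_sum ler_nat sum_rep_le_zrep. Qed.

Lemma zsorted_zrep e (c b : nat) : (c <= p)%N -> (b <= p)%N ->
  zsorted e (fun z : 'Z_p => (zrep (sgmul e (bsign b)) c b z)%:R : R).
Proof. by move=> cp bp k kp; rewrite ler_nat zrep_sorted // leqnSn. Qed.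

(** The right-hand side is the sum over [C] of [F] convolved with the indicator of [B]. The set [B]
    is reflected because [rep] counts sums, not differences. *)
Lemma sum_mul_rep F (B C : {set 'Z_p}) :
  \sum_z F z * (rep C [set z | - z \in B] z)%:R = \sum_(j in B) \sum_(c in C) F (c - j).
Proof.
under eq_bigr do rewrite natr_sum mulr_sumr.
rewrite exchange_big [RHS]exchange_big [RHS]big_mkcond /=; apply: eq_bigr => c _.
case: ifP => cC; last by rewrite big1 // => z _; rewrite mul0n mulr0.
rewrite [RHS]big_mkcond (reindex_inj (subrI c)) /=; apply: eq_bigr => j _.
rewrite inE mul1n addrAC subrr sub0r opprK.
by case: (j \in B); rewrite ?mulr1 ?mulr0.
Qed.

Lemma sum_mul_zrep d G (c b : nat) :
  \sum_z G z * (zrep d c b z)%:R = \sum_(j < b) \sum_(i < c) G (zz p d i - zz p d j).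
Proof.
under eq_bigr do rewrite natr_sum mulr_sumr.
rewrite exchange_big [RHS]exchange_big /=; apply: eq_bigr => i _.
under eq_bigr do rewrite natr_sum mulr_sumr.
rewrite exchange_big /=; apply: eq_bigr => j _.
rewrite (bigD1 (zz p d i - zz p d j)) //= eqxx mulr1 big1 ?addr0 // => z.
by rewrite eq_sym => /negPf ->; rewrite mulr0.
Qed.

Lemma sum_by_parts (n : nat) (y s : nat -> R) : s n = 0 ->
  \sum_(k < n) y k * s k = \sum_(k < n) (s k - s k.+1) * \sum_(j < k.+1) y j.
Proof.
move=> sn; suff E m : \sum_(k < m) y k * s k =
    \sum_(k < m) (s k - s k.+1) * (\sum_(j < k.+1) y j) + s m * \sum_(j < m) y j.
  by rewrite E sn mul0r addr0.
elim: m => [|m IH]; first by rewrite !big_ord0 mulr0 addr0.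
rewrite big_ord_recr [in RHS]big_ord_recr /= IH [\sum_(j < m.+1) y j]big_ord_recr /=.
ring.
Qed.

End RealMajorization.

(** * Rearranging a regular factor *)

Section LayerCake.
Variables (R : realType) (p : nat).
Hypotheses (p_pr : prime p) (p3 : (3 <= p)%N).
Implicit Types (F G h : {ffun 'Z_p -> R}) (d : sign) (k : kind).

(** The default value 0 at index [p] makes the minimum of [h] the height of the layer of full size
    [p]. *)
Definition dval h i : R := nth 0 (sort >=%R (codom h)) i.

Lemma size_dval h : size (sort >=%R (codom h)) = p.
Proof. by rewrite size_sort size_codom card_Zp_type. Qed.

Lemma dval_size h : dval h p = 0.
Proof. by rewrite /dval nth_default // size_dval. Qed.

Lemma dval_desc h i : (i < p)%N -> dval h i = h (nth 0 (desc h) i).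
Proof. by move=> ip; rewrite /dval codomE -map_desc (nth_map 0) // size_desc. Qed.

Lemma dval_decr h i : (forall z, 0 <= h z) -> (i < p)%N -> dval h i.+1 <= dval h i.
Proof.
move=> h0; rewrite leq_eqVlt => /orP[/eqP ip|ip].
  by rewrite ip dval_size dval_desc ?h0 // -ip.
by rewrite !dval_desc ?nth_desc_le // ltnW.
Qed.

Lemma rearr_zz d h i : (i < p)%N -> rearr d h (zz p d i) = dval h i.
Proof. by move=> ip; rewrite ffunE index_zz. Qed.

Lemma dval_rearr d h i : dval (rearr d h) i = dval h i.
Proof.
rewrite /dval; congr nth; apply/perm_sortP; last exact: rearr_perm.
- by move=> x y; exact: le_total.
- by move=> y x z yx zy; exact: le_trans zy yx.
- by move=> x y; rewrite andbC; exact: le_anti.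
Qed.

Lemma sum_mul_layers (phi : 'Z_p -> R) h :
  \sum_z phi z * h z =
  \sum_(i < p) (dval h i - dval h i.+1) * \sum_(z in top h i.+1) phi z.
Proof.
rewrite (sum_desc p_pr h).
transitivity (\sum_(i < p) phi (nth 0 (desc h) i) * dval h i).
  by apply: eq_bigr => i _; rewrite dval_desc.
rewrite (sum_by_parts (fun i => phi (nth 0 (desc h) i)) (dval_size h)).
by apply: eq_bigr => i _; rewrite sum_top.
Qed.

Lemma sum_mul_rearr_layers d (phi : 'Z_p -> R) h :
  \sum_z phi z * rearr d h z =
  \sum_(i < p) (dval h i - dval h i.+1) * \sum_(j < i.+1) phi (zz p d j).
Proof.
rewrite (@big_zigzag _ _ _ p d) //.
rewrite -(sum_by_parts (fun i => phi (zz p d i)) (dval_size h)).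
by apply: eq_bigr => i _; rewrite rearr_zz.
Qed.

Definition ksign k : sign := if k is Triangle then Plus else Minus.

(* h is the sum over i of (dval h i - dval h i.+1) times the indicator of top h i.+1:
   only sets of odd size contribute for Triangle, of even size for Square. *)
Definition layer_kind k h :=
  forall i, (i < p)%N -> dval h i = dval h i.+1 \/ bsign i.+1 = ksign k.

Lemma convEr F G z : conv F G z = \sum_j F (z - j) * G j.
Proof. by rewrite convC convE; apply: eq_bigr => j _; rewrite mulrC. Qed.

Lemma conv_ge0 F G : (forall z, 0 <= F z) -> (forall z, 0 <= G z) ->
  forall z, 0 <= conv F G z.
Proof. by move=> F0 G0 z; rewrite convE sumr_ge0 // => i _; rewrite mulr_ge0. Qed.

Lemma rearr_ge0 d h : (forall z, 0 <= h z) -> forall z, 0 <= rearr d h z.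
Proof.
move=> h0 z; rewrite ffunE; set i := index _ _.
have [ip|pi] := ltnP i p; first by rewrite -/(dval h i) dval_desc.
by rewrite nth_default // size_dval.
Qed.

(** Both sides expand over the layers of [h] with the same nonnegative weights. On one layer, the
    left pairs [F] with [rep] and the right pairs [G] with [zrep]; [maj_sum_mul] compares them, as a
    count of sign [sgmul e (bsign b)] is sorted along [e]. *)
Lemma maj_conv_rearr e k F G h :
  (forall z, 0 <= G z) -> (forall z, 0 <= h z) -> layer_kind k h ->
  maj e F G -> zsorted e G ->
  maj (sgmul e (ksign k)) (conv F h) (conv G (rearr (sgmul e (ksign k)) h)).
Proof.
move=> G0 h0 hk FG GS C; set d := sgmul e _.
have Cp : (#|C| <= p)%N by rewrite -[X in (_ <= X)%N](card_Zp_type p_pr) max_card.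
under eq_bigr do rewrite convEr.
rewrite exchange_big; under eq_bigr do rewrite -mulr_suml.
rewrite (sum_mul_layers (fun j => \sum_(c in C) F (c - j))).
under [leRHS]eq_bigr do rewrite convEr.
rewrite [leRHS]exchange_big; under [leRHS]eq_bigr do rewrite -mulr_suml.
rewrite (sum_mul_rearr_layers d (fun j => \sum_(i < #|C|) G (zz p d i - j))).
apply: ler_sum => i _; have [->|bk] := hk i (ltn_ord i).
  by rewrite subrr !mul0r.
apply: ler_wpM2l; first by rewrite subr_ge0 dval_decr.
rewrite -sum_mul_rep -sum_mul_zrep.
have cB : #|[set z : 'Z_p | - z \in top h i.+1]| = i.+1.
  rewrite -[RHS](card_top p_pr h (ltn_ord i)) -[in RHS](card_imset _ oppr_inj).
  apply: eq_card => z; rewrite inE; apply/idP/imsetP => [zB|[y yB ->]].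
    by exists (- z); rewrite ?opprK.
  by rewrite opprK.
apply: (@maj_sum_mul _ _ p_pr e) => //.
- have := @maj_rep R _ p_pr p3 e [set z | - z \in top h i.+1] C.
  by rewrite cB bk.
- by have := @zsorted_zrep R _ p_pr p3 e _ i.+1 Cp (ltn_ord i); rewrite bk.
Qed.

End LayerCake.

(** * Regular functions and the choice of signs *)

Section Regular.
Variables (R : realType) (p : nat).
Hypotheses (p_pr : prime p) (p3 : (3 <= p)%N).
Implicit Types (F G h : {ffun 'Z_p -> R}) (d e : sign) (k : kind).

(** For odd [i], the same point has index [i] in the [Plus] zigzag and [i.+1] in the [Minus] zigzag,
    so regularity equates two consecutive values. *)
Lemma tri_layer_kind h : tri_regular h -> layer_kind Triangle h.
Proof.
move=> tri i ip; have op := odd_prime_ge3 p_pr p3.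
rewrite /bsign /=; have [oi|ei] := boolP (odd i); [left|by right].
have ip1 : (i.+1 < p)%N by lia.
rewrite -(rearr_zz p_pr p3 Plus h ip) -(rearr_zz p_pr p3 Minus h ip1) -tri.
by rewrite /zz /= oi /= opprK; congr (rearr _ _ _%:R); lia.
Qed.

Lemma dval_le h i j : (forall z, 0 <= h z) -> (i <= j < p)%N -> dval h j <= dval h i.
Proof.
move=> h0 /andP[ij jp]; elim: j ij jp => [|j IH]; first by case: i.
rewrite leq_eqVlt => /orP[/eqP->//|ij] jp.
by apply: le_trans (dval_decr _ h0 _) (IH _ _) => //; exact: ltnW.
Qed.

Lemma dval_index h z : h z = dval h (index z (desc h)).
Proof.
have zd : z \in desc h by rewrite (perm_mem (desc_perm h)) mem_enum.
by rewrite dval_desc // ?nth_index // -[X in (_ < X)%N](size_desc p_pr h) index_mem.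
Qed.

Lemma sq_layer_kind h : (forall z, 0 <= h z) -> sq_regular h -> layer_kind Square h.
Proof.
move=> h0 [hz|[supp sq]] i ip.
  have dval0 j : dval h j = 0.
    have [jp|pj] := ltnP j p; first by rewrite dval_desc // hz.
    by rewrite /dval nth_default // size_dval.
  by left; rewrite !dval0.
have op := odd_prime_ge3 p_pr p3.
rewrite /bsign /=; have [oi|ei] := boolP (odd i); [by right|left].
(* For even [i], the [Plus] point of index [i.+1] is one more than the [Minus] point of index [i],
   as in the definition of square regularity. *)
have [ip1|] := ltnP i.+1 p.
  rewrite -(rearr_zz p_pr p3 Minus h ip) -(rearr_zz p_pr p3 Plus h ip1).
  rewrite /zz /= (negPf ei) /= opprK -sq; congr (rearr _ _ _).
  by rewrite natr1.
(* For the layer of full size: [p] is odd and the support even, so [h] vanishes somewhere and its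
   minimum is 0. *)
move=> pi; have -> : i.+1 = p by apply/eqP; rewrite eqn_leq ip pi.
rewrite dval_size //; apply/eqP; apply: contraT => si0.
case/negP: supp; rewrite (eq_card (B := predT)) ?card_Zp_type // => z.
rewrite !inE; apply/eqP => hz0; case/negP: si0; rewrite eq_le.
rewrite [X in _ && (_ <= X)]dval_desc // h0 andbT -hz0 dval_index dval_le //.
have : z \in desc h by rewrite (perm_mem (desc_perm h)) mem_enum.
by rewrite -index_mem size_desc // => zp; apply/andP; split => //; lia.
Qed.

Lemma dirac0_ge0 z : 0 <= dirac0 R p z.
Proof. by rewrite ffunE ler0n. Qed.

Lemma zsorted_dirac0 d : zsorted d (dirac0 R p).
Proof.
move=> k kp; have zz0 : zz p d 0 = 0 by case: d; rewrite /zz /= ?oppr0.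
have /negPf zzN0 : zz p d k.+1 != 0.
  apply/eqP => e; have := index_zz d p_pr p3 kp.
  by rewrite e -zz0 index_zz //; lia.
by rewrite ffunE zzN0 dirac0_ge0.
Qed.

Lemma bigconv_ge0 (I : Type) (r : seq I) (h : I -> {ffun 'Z_p -> R}) :
  (forall i z, 0 <= h i z) ->
  forall z, 0 <= (\big[@conv R p/dirac0 R p]_(i <- r) h i) z.
Proof.
by move=> h0; elim/big_rec: _ => [|i F _ F0]; [exact: dirac0_ge0|exact: conv_ge0].
Qed.

Lemma rearr_rearr d e h : rearr d (rearr e h) = rearr d h.
Proof. by apply/ffunP => z; rewrite !ffunE -!/(dval _ _) dval_rearr. Qed.

(** The first factor receives the target sign [e]. Convolving with it multiplies the sign by
    [ksign (k x)], so the other factors are asked to be sorted along [sgmul e (ksign (k x))], which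
    the induction over all [e] provides. *)
Lemma exists_signs (I : eqType) (r : seq I) (h : I -> {ffun 'Z_p -> R}) (k : I -> kind) e :
  uniq r -> (forall i z, 0 <= h i z) -> (forall i, layer_kind (k i) (h i)) ->
  exists delta : I -> sign,
    let G := \big[@conv R p/dirac0 R p]_(i <- r) rearr (delta i) (h i) in
    maj e (\big[@conv R p/dirac0 R p]_(i <- r) h i) G /\ zsorted e G.
Proof.
move=> + h0 hk; elim: r e => [|x r IH] e /=.
  move=> _; exists (fun=> Plus); rewrite !big_nil; split; last exact: zsorted_dirac0.
  apply: zsorted_maj => //; [exact: dirac0_ge0 | exact: zsorted_dirac0].
move=> /andP[xr ur]; have [delta [FG GS]] := IH (sgmul e (ksign (k x))) ur.
have ee : sgmul (sgmul e (ksign (k x))) (ksign (k x)) = e.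
  by case: (e); case: (k x).
exists (fun i => if i == x then e else delta i); rewrite !big_cons eqxx.
have -> : \big[@conv R p/dirac0 R p]_(i <- r) rearr (if i == x then e else delta i) (h i) =
    \big[@conv R p/dirac0 R p]_(i <- r) rearr (delta i) (h i).
  by apply: eq_big_seq => i ir; rewrite (negPf (memPn xr i ir)).
set F := (X in conv (h x) X) in FG *; set G := (X in conv (rearr _ _) X) in FG GS *.
have G0 : forall z, 0 <= G z by apply: bigconv_ge0 => i; exact: rearr_ge0.
rewrite [conv (h x) F]convC [conv (rearr _ _) G]convC; split.
  by have := maj_conv_rearr p_pr p3 G0 (h0 x) (hk x) FG GS; rewrite ee.
(* Sortedness follows from the same majorization with [G] in place of [F] and the rearranged factor
   in place of [h x]. *)
apply: maj_zsorted => //.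
have := @maj_conv_rearr R p p_pr p3 (sgmul e (ksign (k x))) (k x) G G (rearr e (h x)) G0.
rewrite ee rearr_rearr; apply => //.
- exact: rearr_ge0.
- by move=> i ip; rewrite !dval_rearr //; exact: hk.
- exact: zsorted_maj.
Qed.

(** * Translates and the comparison of admissible signs *)

Definition translate F G := exists s, forall z, F z = G (z + s).

Lemma translate_conv F F' G G' : translate F F' -> translate G G' ->
  translate (conv F G) (conv F' G').
Proof.
move=> [s Fs] [t Gt]; exists (s + t) => z; rewrite !convE.
rewrite [RHS](reindex_inj (addIr s)) /=; apply: eq_bigr => i _.
by rewrite Fs Gt; congr (_ * G' _); ring.
Qed.

(** The shift is 0 for triangle-regular functions, and 1 or -1 for nonzero square-regular ones when
    the signs differ. *)
Lemma translate_rearr k h d e : 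
  match k with Triangle => tri_regular h | Square => sq_regular h end ->
  translate (rearr d h) (rearr e h).
Proof.
have refl : translate (rearr d h) (rearr d h) by exists 0 => z; rewrite addr0.
case: k => [tri|[h0|[_ sq]]].
- by exists 0 => z; rewrite addr0; case: (d); case: (e).
- have r0 c z : rearr c h z = 0.
    rewrite ffunE; set i := index _ _; have [ip|pi] := ltnP i p.
      by rewrite -/(dval h i) dval_desc.
    by rewrite nth_default // size_dval.
  by exists 0 => z; rewrite !r0.
- case: d refl; case: e => // _.
    by exists (- 1) => z; rewrite -sq subrK.
  by exists 1 => z; rewrite sq.
Qed.

Lemma translate_bigconv (I : Type) (r : seq I) (h h' : I -> {ffun 'Z_p -> R}) :
  (forall i, translate (h i) (h' i)) ->
  translate (\big[@conv R p/dirac0 R p]_(i <- r) h i)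
            (\big[@conv R p/dirac0 R p]_(i <- r) h' i).
Proof.
move=> hh; apply: (big_ind2 translate) => [|F F' G G' FF GG|i _]; last exact: hh.
  by exists 0 => z; rewrite addr0.
exact: translate_conv.
Qed.

(** The first [#|C|] zigzag values of [G] are the values of [G'] on a translated set of the same
    size, whose sum is at most that of the first [#|C|] zigzag values of the sorted [G']. *)
Lemma maj_translate e F G G' : translate G G' -> maj e F G -> (forall z, 0 <= G' z) ->
  zsorted e G' -> maj e F G'.
Proof.
move=> [s GG'] FG G'0 G'S C; apply: le_trans (FG C) _.
have Cp : (#|C| <= p)%N by rewrite -[X in (_ <= X)%N](card_Zp_type p_pr) max_card.
pose D := [set z | index (z - s) (zigzag p e) \in gtn #|C|].
have sumD (T : Type) (idx : T) (op : Monoid.com_law idx) (phi : 'Z_p -> T) :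
    \big[op/idx]_(z in D) phi z = \big[op/idx]_(i < #|C|) phi (zz p e i + s).
  rewrite (big_ord_widen p (fun i => phi (zz p e i + s))) //.
  rewrite -(big_zz_index _ e (fun i => i < #|C|)%N (fun z => phi (z + s))) //.
  rewrite (reindex_inj (addIr s)); apply: eq_bigl => z.
  by rewrite !inE addrK.
have DC : #|D| = #|C| by rewrite -sum1_card (sumD _ _ addn) sum_nat_const card_ord muln1.
have := zsorted_maj p_pr p3 G'0 G'S D; rewrite DC (sumD _ _ +%R).
by under eq_bigr do rewrite -GG'.
Qed.

Lemma orderings_plusP F : (orderings_plus p `<=` orderings F)%classic <-> zsorted Plus F.
Proof.
have [u sz] := zigzag_uniq Plus p_pr p3; have op := odd_prime_ge3 p_pr p3.
split=> [/(_ _ erefl) [_ /(sortedP 0) FS] k kp|FS _ ->].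
  by have := FS k; rewrite sz !nth_zigzag ?(ltnW kp) //; exact.
split; first exact: zigzag_perm.
apply/(sortedP 0) => k; rewrite sz => kp.
by rewrite !nth_zigzag ?(ltnW kp) //; exact: FS.
Qed.

Lemma sum_conv F G : \sum_z conv F G z = (\sum_z F z) * (\sum_z G z).
Proof.
under eq_bigr do rewrite convE; rewrite exchange_big mulr_suml /=.
apply: eq_bigr => i _; rewrite -mulr_sumr; congr (_ * _).
by rewrite (reindex_inj (addIr i)) /=; apply: eq_bigr => z _; rewrite addrK.
Qed.

Lemma sum_bigconv (I : Type) (r : seq I) (h : I -> {ffun 'Z_p -> R}) :
  \sum_z (\big[@conv R p/dirac0 R p]_(i <- r) h i) z = \prod_(i <- r) \sum_z h i z.
Proof.
apply: (big_morph (fun F : {ffun 'Z_p -> R} => \sum_z F z)); first exact: sum_conv.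
rewrite (bigD1 0) //= ffunE eqxx big1 ?addr0 // => z /negPf z0.
by rewrite ffunE z0.
Qed.

Lemma sum_rearr d h : \sum_z rearr d h z = \sum_z h z.
Proof.
have E (F : {ffun 'Z_p -> R}) : \sum_z F z = \sum_(x <- codom F) x.
  by rewrite codomE big_map big_enum.
by rewrite !E; apply: perm_big; exact: rearr_perm.
Qed.

End Regular.

(** * Schur concavity of Renyi entropy and the theorem *)

(** Young's inequality for y^a and x^(1 - a) with exponents 1/a and 1/(1 - a), multiplied by x^(a -
    1). *)
Lemma powR_tangent_concave (R : realType) (a x y : R) : 0 < a < 1 -> 0 < x -> 0 <= y ->
  y `^ a <= x `^ a + a * x `^ (a - 1) * (y - x).
Proof.
move=> /andP[a0 a1] x0 y0.
have xa : x `^ a = x `^ (a - 1) * x by rewrite mulrC mulr_powRB1 ?ltW.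
have a1' : 0 < 1 - a by rewrite subr_gt0.
have := @conjugate_powR R (y `^ a) (x `^ (1 - a)) a^-1 (1 - a)^-1.
rewrite !powR_ge0 !invr_gt0 !invrK a0 a1' -!powRrM !mulfV ?gt_eqF // !powRr1 ?(ltW x0) //.
move=> /(_ isT isT isT isT); rewrite addrC subrK => /(_ erefl) young.
have xx : x `^ (1 - a) * x `^ (a - 1) = 1.
  by rewrite -[1 - a]opprB powRN mulVf // gt_eqF // powR_gt0.
have := ler_wpM2r (powR_ge0 x (a - 1)) young.
rewrite -[X in X <= _ -> _]mulrA xx mulr1 xa; move: (x `^ (a - 1)) (y `^ a) => u v; lra.
Qed.

(** Young's inequality for y and x^(a - 1) with exponents a and a/(a - 1), multiplied by a. *)
Lemma powR_tangent_convex (R : realType) (a x y : R) : 1 < a -> 0 < x -> 0 <= y ->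
  x `^ a + a * x `^ (a - 1) * (y - x) <= y `^ a.
Proof.
move=> a1 x0 y0; have a0 : 0 < a by rewrite (lt_trans _ a1).
have a1' : 0 < a - 1 by rewrite subr_gt0.
have xa : x `^ a = x `^ (a - 1) * x by rewrite mulrC mulr_powRB1 ?ltW.
have := @conjugate_powR R y (x `^ (a - 1)) a (a / (a - 1)).
rewrite y0 powR_ge0 a0 divr_gt0 // -powRrM mulrCA mulfV ?gt_eqF // mulr1 invf_div.
move=> /(_ isT isT isT isT); have -> : a^-1 + (a - 1) / a = 1 by field; rewrite gt_eqF.
move=> /(_ erefl); rewrite -(ler_pM2l a0) => young.
have e : a * (y `^ a / a + x `^ a * ((a - 1) / a)) = y `^ a + x `^ a * (a - 1).
  by field; rewrite gt_eqF.
rewrite e in young; rewrite xa in young *.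
by move: young; move: (x `^ (a - 1)) (y `^ a) => u v young; lra.
Qed.

(** For y > 0, this is ln u <= u - 1 at u = x/y, multiplied by y. *)
Lemma xlnx_tangent (R : realType) (x y : R) : 0 < x -> 0 <= y ->
  x * ln x + (1 + ln x) * (y - x) <= y * ln y.
Proof.
move=> x0; rewrite le_eqVlt => /predU1P[<-|y0].
  by rewrite mul0r; lra.
have xy0 : 0 < x / y by rewrite divr_gt0.
have : ln (x / y) <= x / y - 1.
  by have := @le_ln1Dx R (x / y - 1); rewrite (addrC 1) subrK; apply; lra.
rewrite ln_div ?posrE // => h.
have : y * (ln x - ln y) <= y * (x / y - 1) by rewrite ler_pM2l.
rewrite mulrBr mulrBr mulrCA mulfV ?gt_eqF // !mulr1.
by move: (ln x) (ln y) => u v; lra.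
Qed.

Section Pmf.
Variables (R : realType) (p : nat) (h : {ffun 'Z_p -> R}).
Hypothesis h_pmf : is_pmf h.

Lemma pmf_neq0 : exists z, 0 < h z.
Proof.
have [h0 h1] := h_pmf; apply/existsP; apply: contraT => /existsPn hz.
have := oner_eq0 R; rewrite -h1 big1 ?eqxx // => z _.
by apply/le_anti; rewrite h0 andbT leNgt hz.
Qed.

Lemma card_pmf_supp_gt0 : (0 < #|[pred z | (h z != 0)%R]|)%N.
Proof. by have [z hz] := pmf_neq0; apply/card_gt0P; exists z; rewrite inE gt_eqF. Qed.

Lemma bigmax_pmf_gt0 : 0 < \big[Num.max/0]_z h z.
Proof. by have [z hz] := pmf_neq0; apply: lt_le_trans hz _; exact: le_bigmax. Qed.

Lemma sum_pmf_powR_gt0 (a : R) : 0 < \sum_z h z `^ a.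
Proof.
have [z hz] := pmf_neq0; rewrite (bigD1 z) //= ltr_pwDl ?powR_gt0 //.
by rewrite sumr_ge0 // => i _; exact: powR_ge0.
Qed.

End Pmf.

(** * Entropy under majorization *)

Section Renyi.
Variables (R : realType) (p : nat) (d : sign) (F G : {ffun 'Z_p -> R}).
Hypotheses (p_pr : prime p) (p3 : (3 <= p)%N).
Hypotheses (F0 : forall z, 0 <= F z) (G0 : forall z, 0 <= G z).
Hypotheses (F1 : \sum_z F z = 1) (G1 : \sum_z G z = 1).
Hypothesis FG : maj d F G.

(** The first [#|C|] zigzag points already carry the whole mass of [G]. *)
Lemma maj_tail0 (C : {set 'Z_p}) i : \sum_(z in C) F z = 1 -> (#|C| <= i < p)%N ->
  G (zz p d i) = 0.
Proof.
move=> FC /andP[Ci ip]; have := FG C; rewrite FC -G1 (@big_zigzag _ _ _ p d) //.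
have Cp : (#|C| <= p)%N by rewrite -[X in (_ <= X)%N](card_Zp_type p_pr) max_card.
rewrite [leRHS](big_ord_widen p (fun k => G (zz p d k))) //.
rewrite [leLHS](bigID (fun k : 'I_p => (k < #|C|)%N)) /= gerDl.
rewrite (bigD1 (Ordinal ip)) /= -?leqNgt // => le0.
apply: le_anti; rewrite G0 andbT; apply: le_trans le0.
by rewrite lerDl sumr_ge0.
Qed.

Lemma sum_supp (C : {set 'Z_p}) : (forall z, F z != 0 -> z \in C) ->
  \sum_(z in C) F z = 1.
Proof.
move=> supp; rewrite -F1 [RHS](bigID (mem C)) /= [X in _ + X]big1 ?addr0 // => z zC.
by apply/eqP; apply: contraNT zC; exact: supp.
Qed.

(** Karamata's inequality, with [c] the slope of a tangent to [phi]. Tangents are taken at positive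
    points only, since the slopes of x ln x, and of -x^a for a < 1, are unbounded near 0. *)
Lemma maj_sum_convex (phi c : R -> R) : phi 0 = 0 ->
  (forall x y, 0 < x -> 0 <= y -> phi x + c x * (y - x) <= phi y) ->
  (forall x y, 0 < x -> x <= y -> c x <= c y) ->
  \sum_z phi (F z) <= \sum_z phi (G z).
Proof.
move=> phi0 tangent c_mono.
(* Here [k] is the number of positive values of [F]; from index [k] on, both [f] and [G] along the
   zigzag vanish. *)
pose f i := F (nth 0 (desc F) i); pose k := find (fun z => F z == 0) (desc F).
have kp : (k <= p)%N by rewrite -[X in (_ <= X)%N](size_desc p_pr F) find_size.
have f_pos i : (i < k)%N -> 0 < f i.
  by move=> ik; rewrite lt_def F0 andbT /f (before_find 0 ik).
have f_decr i j : (i <= j < p)%N -> f j <= f i.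
  move=> /andP[ij jp]; elim: j ij jp => [|j IH]; first by case: i.
  rewrite leq_eqVlt => /orP[/eqP->//|ij] jp.
  by apply: le_trans (nth_desc_le p_pr F jp) (IH _ _) => //; exact: ltnW.
have f_0 i : (k <= i < p)%N -> f i = 0.
  move=> ki; apply/le_anti; rewrite F0 andbT; apply: le_trans (f_decr _ _ ki) _.
  rewrite le_eqVlt -/(f k); apply/orP; left; apply: (nth_find 0 (a := fun z => F z == 0)).
  by rewrite has_find size_desc //; case/andP: ki; exact: leq_ltn_trans.
have topF : \sum_(z in top F k) F z = 1.
  apply: sum_supp => z; apply: contraR => ztop.
  have zd : z \in desc F by rewrite (perm_mem (desc_perm F)) mem_enum.
  have ip : (index z (desc F) < p)%N by rewrite -[X in (_ < X)%N](size_desc p_pr F) index_mem.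
  rewrite -(nth_index 0 zd) -/(f _) f_0 // ip andbT leqNgt.
  by apply: contra ztop; rewrite inE in_take // (perm_mem (desc_perm F)) mem_enum.
have g_0 i : (k <= i < p)%N -> G (zz p d i) = 0.
  by move=> ki; apply: (maj_tail0 topF); rewrite card_top.
have restrict (h : nat -> R) : (forall i, (k <= i < p)%N -> h i = 0) ->
    \sum_(i < p) h i = \sum_(i < k) h i.
  move=> h0; rewrite [RHS](big_ord_widen p h) // [RHS]big_mkcond /=.
  by apply: eq_bigr => i _; case: ltnP => // ki; rewrite h0 // ki ltn_ord.
have sF : \sum_z phi (F z) = \sum_(i < k) phi (f i).
  rewrite (sum_desc p_pr F) -(restrict (fun i => phi (f i))) //.
  by move=> i ki; rewrite f_0.
have sG : \sum_z phi (G z) = \sum_(i < k) phi (G (zz p d i)).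
  rewrite (@big_zigzag _ _ _ p d) // (restrict (fun i => phi (G (zz p d i)))) //.
  by move=> i ki; rewrite g_0.
have totF : \sum_(i < k) f i = 1.
  by rewrite -F1 (sum_desc p_pr F) -(restrict f) // => i ki; rewrite f_0.
have totG : \sum_(i < k) G (zz p d i) = 1.
  by rewrite -G1 (@big_zigzag _ _ _ p d) // (restrict (fun i => G (zz p d i))).
rewrite sF sG -subr_ge0 -sumrB.
apply: (@le_trans _ _ (\sum_(i < k) (G (zz p d i) - f i) * c (f i))); last first.
  apply: ler_sum => i _; have := tangent _ _ (f_pos i (ltn_ord i)) (G0 (zz p d i)).
  by rewrite mulrC; lra.
case: k kp f_pos totF totG {f_0 topF g_0 restrict sF sG} => [|k] kp f_pos totF totG.
  by rewrite big_ord0.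
(* The slopes decrease with the values [f i], and the differences have nonnegative partial sums and
   total 0. *)
apply: le_trans (abel_sum (D := fun i => G (zz p d i) - f i) (g := fun i => c (f i)) _ _).
- by rewrite sumrB totF totG subrr mulr0.
- move=> m mk; have mp := leq_trans mk kp; rewrite sumrB subr_ge0 -(sum_top p_pr) //.
  by have := FG (top F m); rewrite card_top.
- move=> i ik; apply: c_mono; first exact: f_pos.
  by apply: f_decr; rewrite leqnSn; exact: leq_trans kp.
Qed.

Lemma maj_card_supp : (#|[pred z | (G z != 0)%R]| <= #|[pred z | (F z != 0)%R]|)%N.
Proof.
pose C := [set z | F z != 0].
have FC : \sum_(z in C) F z = 1 by apply: sum_supp => z; rewrite inE.
have -> : #|[pred z | F z != 0]| = #|C| by rewrite cardsE.
rewrite -[leqLHS]sum1_card big_mkcond (@big_zigzag _ _ _ p d) //.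
apply: (@leq_trans (\sum_(i < p) (i < #|C|))); last first.
  by rewrite sum_ltn_ord; exact: geq_minr.
apply: leq_sum => i _; case: ifP => //; rewrite inE; apply: contraNT.
by rewrite lt0b -leqNgt => Ci; rewrite (maj_tail0 FC) // Ci ltn_ord.
Qed.

Lemma maj_renyi (alpha : \bar R) : (0 <= alpha)%E -> renyi alpha G <= renyi alpha F.
Proof.
case: alpha => [a| |] //=; last first.
  move=> _; rewrite lerN2 ler_ln ?posrE ?bigmax_pmf_gt0 //.
  apply/bigmax_leP; split=> [|z _]; first exact: bigmax_ge_id.
  have := FG [set z]; rewrite big_set1 cards1 big_ord1 => /le_trans; apply.
  exact: le_bigmax.
rewrite lee_fin => a0.
have [_|aN0] := eqVneq a 0.
  by rewrite ler_ln ?posrE ?ltr0n ?card_pmf_supp_gt0 // ler_nat maj_card_supp.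
have [_|aN1] := eqVneq a 1.
  rewrite lerN2.
  apply: (maj_sum_convex (phi := fun x => x * ln x) (c := fun x => 1 + ln x)).
  - by rewrite mul0r.
  - by move=> x y; exact: xlnx_tangent.
  - by move=> x y x0 xy; rewrite lerD2l ler_ln ?posrE // (lt_le_trans x0).
have {}a0 : 0 < a by rewrite lt_def aN0.
have [a1|a1|a1] := ltgtP a 1; last by rewrite a1 eqxx in aN1.
(* The prefactor 1/(1 - a) is positive and the convex function is -x^a. *)
- rewrite ler_pM2l ?invr_gt0 ?subr_gt0 // ler_ln ?posrE ?sum_pmf_powR_gt0 // -lerN2 -!sumrN.
  apply: (maj_sum_convex (phi := fun x => - x `^ a) (c := fun x => - (a * x `^ (a - 1)))).
  + by rewrite powR0 ?oppr0.
  + move=> x y x0 y0; have := @powR_tangent_concave R a x y; rewrite a0 a1 x0 y0.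
    by move=> /(_ isT isT isT); lra.
  + move=> x y x0 xy; have y0 := lt_le_trans x0 xy.
    rewrite lerN2 ler_pM2l // -opprB !powRN lef_pV2 ?posrE ?powR_gt0 //.
    by apply: ge0_ler_powR; rewrite ?nnegrE ?subr_ge0 ?(ltW a1) ?(ltW x0) ?(ltW y0).
(* The prefactor is now negative and the convex function is x^a. *)
- rewrite ler_nM2l ?invr_lt0 ?subr_lt0 // ler_ln ?posrE ?sum_pmf_powR_gt0 //.
  apply: (maj_sum_convex (phi := fun x => x `^ a) (c := fun x => a * x `^ (a - 1))).
  + by rewrite powR0.
  + by move=> x y; exact: powR_tangent_convex.
  + move=> x y x0 xy; have y0 := lt_le_trans x0 xy; rewrite ler_pM2l //.
    by apply: ge0_ler_powR; rewrite ?nnegrE ?subr_ge0 ?(ltW a1) ?(ltW x0) ?(ltW y0).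
Qed.

End Renyi.

(** * Distributivity of convolution over addition *)

Lemma conv_zerol (R : realType) (p : nat) : left_zero 0 (@conv R p).
Proof.
move=> F; apply/ffunP => z; rewrite convE ffunE big1 // => i _.
by rewrite ffunE mul0r.
Qed.

Lemma conv_zeror (R : realType) (p : nat) : right_zero 0 (@conv R p).
Proof. by move=> F; rewrite convC conv_zerol. Qed.

Lemma conv_addl (R : realType) (p : nat) : left_distributive (@conv R p) +%R.
Proof.
move=> F G H; apply/ffunP => z; rewrite [RHS]ffunE !convE -big_split /=.
by apply: eq_bigr => i _; rewrite ffunE mulrDl.
Qed.

Lemma conv_addr (R : realType) (p : nat) : right_distributive (@conv R p) +%R.
Proof. by move=> F G H; rewrite !(convC F) conv_addl. Qed.

HB.instance Definition _ (R : realType) (p : nat) :=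
  Monoid.isMulLaw.Build {ffun 'Z_p -> R} 0 (@conv R p) (@conv_zerol R p) (@conv_zeror R p).

(* A fresh key: the add_law instance of [+%R] is taken by ring multiplication. *)
Definition conv_add (R : realType) (p : nat) : {ffun 'Z_p -> R} -> _ -> _ := +%R.

HB.instance Definition _ (R : realType) (p : nat) :=
  Monoid.isComLaw.Build {ffun 'Z_p -> R} 0 (@conv_add R p)
    (@addrA _) (@addrC _) (@add0r _).

HB.instance Definition _ (R : realType) (p : nat) :=
  Monoid.isAddLaw.Build {ffun 'Z_p -> R} (@conv R p) (@conv_add R p)
    (@conv_addl R p) (@conv_addr R p).

Local Open Scope classical_set_scope.

Theorem theorem3p4 (R : realType) (p n : nat)
    (f : 'I_n -> {ffun 'Z_p -> R})
    (g : 'I_n -> kind -> {ffun 'Z_p -> R}) :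
  prime p -> (3 <= p)%N -> (0 < n)%N ->
  (forall i, is_pmf (f i)) ->
  (forall i, tri_sq_decomposition (f i) (g i Triangle) (g i Square)) ->
  (exists delta, admissible g delta) /\
  (forall (alpha : \bar R) (delta : 'I_n -> {ffun 'I_n -> kind} -> sign),
     (0 <= alpha)%E -> admissible g delta ->
     renyi alpha (\sum_(w : {ffun 'I_n -> kind}) rearr_conv g delta w)
     <= renyi alpha (\big[@conv R p/dirac0 R p]_(i < n) f i)).
Proof.
move=> p_pr p3 _ f_pmf dec.
have g0 i k z : 0 <= g i k z by case: (dec i) => _ [gt gs] _ _ _; case: k.
have g_kind i k : layer_kind k (g i k).
  case: (dec i) => _ [gt gs] tri sq _; case: k; first exact: tri_layer_kind.
  exact: sq_layer_kind.
have rearr_conv_ge0 delta w z : 0 <= rearr_conv g delta w z.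
  by apply: bigconv_ge0 => i y; exact: rearr_ge0.
have [delta0 maj0] := choice (fun w : {ffun 'I_n -> kind} =>
  exists_signs p_pr p3 Plus (index_enum_uniq 'I_n) (fun i z => g0 i (w i) z)
    (fun i => g_kind i (w i))).
split.
  exists (fun i w => delta0 w i) => w; apply/orderings_plusP => //.
  by case: (maj0 w).
move=> alpha delta alpha0 adm.
have majw (w : {ffun 'I_n -> kind}) :
    maj Plus (\big[@conv R p/dirac0 R p]_(i < n) g i (w i)) (rearr_conv g delta w).
  have [maj_w _] := maj0 w.
  (* An arbitrary admissible [delta] yields a translate of the convolution given by [delta0], and
     admissibility makes it sorted. *)
  apply: (maj_translate p_pr p3 _ maj_w) => //.
    apply: translate_bigconv => i; apply: (@translate_rearr _ _ p_pr (w i)).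
    by case: (dec i) => _ _ tri sq _; case: (w i).
  by apply/orderings_plusP => //; exact: adm.
have convfE : \big[@conv R p/dirac0 R p]_(i < n) f i =
    \sum_(w : {ffun 'I_n -> kind}) \big[@conv R p/dirac0 R p]_(i < n) g i (w i).
  transitivity (\big[@conv R p/dirac0 R p]_(i < n) \sum_(k : kind) g i k).
    apply: eq_bigr => i _; have [-> _ _ _ _] := dec i.
    by rewrite (bigD1 Triangle) //= (bigD1 Square) //= big1 ?addr0 //; case.
  exact: (bigA_distr_bigA (plus := @conv_add R p) g).
have sumf : \sum_z (\big[@conv R p/dirac0 R p]_(i < n) f i) z = 1.
  by rewrite sum_bigconv big1 // => i _; case: (f_pmf i).
apply: (maj_renyi (d := Plus)) => //.
- by apply: bigconv_ge0 => i z; case: (f_pmf i).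
- by move=> z; rewrite sum_ffunE sumr_ge0.
- rewrite -sumf convfE; under eq_bigr do rewrite sum_ffunE.
  under [RHS]eq_bigr do rewrite sum_ffunE.
  rewrite exchange_big [RHS]exchange_big; apply: eq_bigr => w _.
  by rewrite !sum_bigconv; apply: eq_bigr => i _; rewrite sum_rearr.
(* For a fixed zigzag both sides of [maj] are linear, and every majorant uses the [Plus] one, so the
   inequalities add up. *)
- move=> C; rewrite convfE; under eq_bigr do rewrite sum_ffunE.
  under [leRHS]eq_bigr do rewrite sum_ffunE.
  by rewrite exchange_big [leRHS]exchange_big; apply: ler_sum => w _; exact: majw.
Qed.
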